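(* Let $F:\mathbb{R}^+\to\mathbb{R}$ be strictly increasing, and let $(L(t),M(t))$, $t\in\mathbb{R}$, be the solution of the generalized finite relativistic Toda lattice $$\dot L=\bigl(F(LM^{-1})\bigr)_-L-L\bigl(F(M^{-1}L)\bigr)_-,\qquad \dot M=\bigl(F(LM^{-1})\bigr)_-M-M\bigl(F(M^{-1}L)\bigr)_-$$ with positive initial data $a_n(0)>0$, $b_n(0)>0$. Let $1\le n\le N$. Then $$\lambda_n-a_n(t)=\frac{\lambda_n}{\lambda_n-\lambda_{n+1}}\,b_n(t)\bigl(1+o(1)\bigr)-\frac{\lambda_n}{\lambda_{n-1}-\lambda_n}\,b_{n-1}(t)\bigl(1+o(1)\bigr)\quad\text{as } t\to+\infty,$$ and $$\lambda_{N-n+1}-a_n(t)=\frac{\lambda_{N-n+1}}{\lambda_{N-n+1}-\lambda_{N-n}}\,b_n(t)\bigl(1+o(1)\bigr)-\frac{\lambda_{N-n+1}}{\lambda_{N-n+2}-\lambda_{N-n+1}}\,b_{n-1}(t)\bigl(1+o(1)\bigr)\quad\text{as } t\to-\infty,$$ where $b_0\equiv0$ and $b_N\equiv0$.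
   Context: $\mathbb{R}^+=(0,\infty)$. For matrix data $a_1,\ldots,a_N>0$ and $b_1,\ldots,b_{N-1}>0$ (functions of $t$), $L$ is the $N\times N$ upper bidiagonal matrix with $L_{n,n}=a_n$, $L_{n,n+1}=1$, all other entries $0$; $M$ is the $N\times N$ lower bidiagonal matrix with $M_{n,n}=1$, $M_{n+1,n}=-b_n$, all other entries $0$. The solution of the system with positive initial data exists uniquely for all $t\in\mathbb{R}$ with $a_n(t)>0$, $b_n(t)>0$. For a square matrix $X$, $X_-$ denotes its strictly lower triangular part. The generalized eigenvalue problem $L\vec x=\lambda M\vec x$ has $N$ distinct positive eigenvalues $0<\lambda_1<\cdots<\lambda_N$ (the zeros of $\det(zM-L)$), which are also the eigenvalues of the diagonalizable matrices $LM^{-1}$ and $M^{-1}L$; along solutions of the system they do not depend on $t$. For a diagonalizable matrix $X=S\,\mathrm{diag}(\lambda_1,\ldots,\lambda_N)S^{-1}$ with positive eigenvalues, $F(X)=S\,\mathrm{diag}(F(\lambda_1),\ldots,F(\lambda_N))S^{-1}$. Terms containing $b_0$ or $b_N$ (for which a $\lambda$ with index $0$ or $N+1$ formally appears) are understood to be $0$. The two $o(1)$ terms in each formula may be different functions of $t$. *)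

(* Defs.v *)
From HB Require Import structures.
From mathcomp Require Import all_boot all_order all_algebra.
From mathcomp Require Import all_classical all_reals all_analysis.

Set Implicit Arguments.
Unset Strict Implicit.
Unset Printing Implicit Defensive.

Import Order.TTheory GRing.Theory Num.Theory.
Import numFieldNormedType.Exports.

Local Open Scope classical_set_scope.
Local Open Scope ring_scope.

(* Sequences of data are functions on nat read from index 1, so row i : 'I_N
   carries the index i.+1: the entry a i.+1 is a_n for n = i.+1. *)
Definition Lmx (R : realType) (N : nat) (a : nat -> R) : 'M[R]_N :=
  \matrix_(i, j) if j == i :> nat then a i.+1
                 else if j == i.+1 :> nat then 1 else 0.

(* Here the entry in row n+1 = i.+1 and column n = j.+1 is - b_n, so only
   b 1, ..., b N.-1 occur. *)
Definition Mmx (R : realType) (N : nat) (b : nat -> R) : 'M[R]_N :=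
  \matrix_(i, j) if j == i :> nat then 1
                 else if i == j.+1 :> nat then - b j.+1 else 0.

Definition strict_lower (R : realType) (N : nat) (X : 'M[R]_N) : 'M[R]_N :=
  \matrix_(i, j) if (j < i)%N then X i j else 0.

Definition mxfun_rel (R : realType) (N : nat) (F : R -> R) (X Y : 'M[R]_N) :
    Prop :=
  exists (S : 'M[R]_N) (d : 'rV[R]_N),
    [/\ S \in unitmx, forall i, 0 < d 0 i,
        X = S *m diag_mx d *m invmx S
      & Y = S *m diag_mx (map_mx F d) *m invmx S].

(* F(X) for X diagonalizable with positive eigenvalues. The value does not
   depend on the diagonalization (mxfunE); for any other X it is 0. *)
Definition mxfun (R : realType) (N : nat) (F : R -> R) (X : 'M[R]_N) : 'M[R]_N :=
  xget 0 [set Y | mxfun_rel F X Y].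

Lemma mxfun_rel_uniq (R : realType) (N : nat) (F : R -> R) (X Y Z : 'M[R]_N) :
  mxfun_rel F X Y -> mxfun_rel F X Z -> Y = Z.
Proof.
move=> [S [d [uS _ XS ->]]] [T [e [uT _ XT ->]]].
pose P := invmx T *m S.
have TP : T *m P = S by rewrite mulmxA mulmxV // mul1mx.
have PdeP : P *m diag_mx d = diag_mx e *m P.
  have : X *m S = S *m diag_mx d by rewrite XS -!mulmxA mulVmx // mulmx1.
  rewrite XT -!mulmxA -/P -{2}TP -mulmxA => /(congr1 (mulmx (invmx T))).
  by rewrite !mulmxA mulVmx // !mul1mx => ->.
have PF : P *m diag_mx (map_mx F d) = diag_mx (map_mx F e) *m P.
  clearbody P; apply/matrixP => i j; move/matrixP/(_ i j): PdeP.
  rewrite !mul_mx_diag !mul_diag_mx !mxE.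
  have [->|P0] := eqVneq (P i j) 0; first by rewrite !mul0r !mulr0.
  by rewrite mulrC => /(mulIf P0) ->; rewrite mulrC.
by rewrite -{1}TP -(mulmxA T) PF -!mulmxA mulmxV // mulmx1.
Qed.

Lemma mxfunE (R : realType) (N : nat) (F : R -> R) (S : 'M[R]_N)
    (d : 'rV[R]_N) :
  S \in unitmx -> (forall i, 0 < d 0 i) ->
  mxfun F (S *m diag_mx d *m invmx S) =
  S *m diag_mx (map_mx F d) *m invmx S.
Proof.
move=> uS d0; apply: xget_unique => [|Y XY]; first by exists S, d.
by apply: mxfun_rel_uniq XY _; exists S, d.
Qed.

Definition gen_eigenvalue (R : realType) (N : nat) (L M : 'M[R]_N) (z : R) :
    Prop :=
  exists2 x : 'cV[R]_N, x != 0 & L *m x = z *: (M *m x).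

Definition toda_solution (R : realType) (N : nat) (F : R -> R)
    (L M : R -> 'M[R]_N) : Prop :=
  forall t : R,
    let A := strict_lower (mxfun F (L t *m invmx (M t))) in
    let B := strict_lower (mxfun F (invmx (M t) *m L t)) in
    is_derive t 1 L (A *m L t - L t *m B) /\
    is_derive t 1 M (A *m M t - M t *m B).

(* Main.v *)
(* Let P_n(z; t) be the characteristic polynomial of the leading n x n block of
   the pencil zM - L. The flow keeps P_N fixed, and P_n is orthogonal to the
   polynomials of degree < n for the discrete measure with mass
   w_i(t) lambda_i^-n at lambda_i, where w_i(t) is proportional to
   w_i(0) exp(-F(lambda_i) t) with w_i(0) > 0. So P_n minimizes
   sum_i w_i lambda_i^-n Q(lambda_i)^2 over the monic Q of degree n; comparing
   with Q = prod_(j <= n) (z - lambda_j) gives P_n(lambda_i; t) -> 0 for i <= n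
   as t -> +oo. Hence a_n -> lambda_n and b_n -> 0. The expansion is then read
   off the three-term expansion of P_N(lambda_n) = 0 around row n. Reversing the
   order of the lambda_i gives t -> -oo. *)
Require Import Defs.
From HB Require Import structures.
From mathcomp Require Import all_boot all_order all_algebra.
From mathcomp Require Import all_classical all_reals all_analysis.
From mathcomp Require Import perm ring lra zify.

Import Order.TTheory GRing.Theory Num.Theory.
Import numFieldNormedType.Exports.

Set Implicit Arguments.
Unset Strict Implicit.

Local Open Scope classical_set_scope.
Local Open Scope ring_scope.

(** * Calculus and linear differential equations *)

(** Orthogonality comes from linear algebra. The values [P_k(lambda_i)] form a matrix [Z] of right
    eigenvectors of the pencil, a rescaling of them gives left eigenvectors [Y], and [Y M Z] is
    diagonal. Inverting this relation turns sums over rows into sums over eigenvalues, with weights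
    inverse to that diagonal; the factor [lambda_i^-n] is part of the rescaling. The weights at time
    [t] are not obtained by differentiating them: the candidate [w_i(0) exp(-F(lambda_i) t)] is
    checked through [M Z w], which stays on the first coordinate axis, and this determines [w] up to
    a scalar. Positivity is given only at [t = 0], while orthogonality at time [t] divides by the
    [b_n(t)]. The constancy of [P_N] is therefore proved without signs. It diagonalizes [L M^-1] and
    [M^-1 L] with fixed eigenvalues, so [F] of these matrices is continuous in [t] although [F] is
    merely monotone, and each [a_n], [b_n] keeps its sign as a solution of a scalar linear
    equation. *)

Section Calculus.
Context {R : realType}.
Implicit Types (f g c : R -> R) (t x : R).

Lemma is_deriveBf f g t a b : is_derive t 1 f a -> is_derive t 1 g b ->
  is_derive t 1 (fun s => f s - g s) (a - b).
Proof. by move=> fa gb; exact: is_deriveB. Qed.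

Lemma is_deriveMf f g t a b : is_derive t 1 f a -> is_derive t 1 g b ->
  is_derive t 1 (fun s => f s * g s) (a * g t + f t * b).
Proof.
move=> fa gb; apply: (@is_derive_eq _ _ _ _ _ _ _ _ (is_deriveM fa gb)).
by rewrite /GRing.scale /= addrC (mulrC (g t)).
Qed.

Lemma is_derive_sumf n (h : 'I_n -> R -> R) (dh : 'I_n -> R) t :
  (forall i, is_derive t 1 (h i) (dh i)) ->
  is_derive t 1 (fun s => \sum_i h i s) (\sum_i dh i).
Proof.
move=> hd; have -> : (fun s => \sum_i h i s) = \sum_i h i.
  by apply/funext => s; rewrite fct_sumE.
exact: is_derive_sum.
Qed.

Lemma is_derive_cstf a t : is_derive t 1 (fun _ => a) (0 : R).
Proof. exact: is_derive_cst. Qed.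

Lemma is_derive_unique f t a b :
  is_derive t 1 f a -> is_derive t 1 f b -> a = b.
Proof. by move=> [_ <-] [_ <-]. Qed.

Lemma is_derive_continuous f (df : R -> R) :
  (forall t, is_derive t 1 f (df t)) -> continuous f.
Proof.
move=> fd t; apply: differentiable_continuous; apply/derivable1_diffP.
by case: (fd t).
Qed.

Lemma is_derive_expRM a t :
  is_derive t 1 (fun s => expR (a * s)) (a * expR (a * t)).
Proof.
have da : is_derive t 1 (fun s => a * s) a.
  have := is_deriveMf (is_derive_cstf a t) (is_derive_id t 1).
  by rewrite mul0r add0r mulr1.
rewrite mulrC.
exact: (@is_derive1_comp _ expR (fun s => a * s)).
Qed.

Lemma continuous_bounded_seg c u v : continuous c ->
  exists2 K, 0 <= K & forall s, u <= s <= v -> `|c s| <= K.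
Proof.
move=> cc; have [uv|vu] := leP u v; last first.
  exists 0 => // s /andP[us sv]; by have := lt_le_trans vu (le_trans us sv); rewrite ltxx.
have cn : {within `[u, v], continuous (fun s => `|c s|)}.
  by apply: continuous_subspaceT => s; apply: cvg_norm; exact: cc.
have [m muv mmax] := EVT_max uv cn.
by exists `|c m| => // s usv; apply: mmax; rewrite in_itv.
Qed.

(* Gronwall: on a segment where [|c| <= K], the function
   [f^2 exp(-2Ks)] is nonincreasing and [f^2 exp(2Ks)] is nondecreasing. *)
Lemma linear_ode_eq0 c f t0 : continuous c ->
  (forall t, is_derive t 1 f (c t * f t)) -> f t0 = 0 -> forall t, f t = 0.
Proof.
move=> cc fd f0 t; apply/eqP; rewrite -sqrf_eq0 eq_le sqr_ge0 andbT.
pose g (k s : R) := f s * f s * expR (k * s).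
have gd (k s : R) : is_derive s 1 (g k) ((2 * c s + k) * g k s).
  have := is_deriveMf (is_deriveMf (fd s) (fd s)) (is_derive_expRM k s).
  by move=> H; apply: is_derive_eq H _; rewrite /g; ring.
have gC k (A : set R) : {within A, continuous (g k)}.
  by apply: continuous_subspaceT; apply: is_derive_continuous (gd k).
have g0 k : g k t0 = 0 by rewrite /g f0 !mul0r.
have gge0 k s : 0 <= g k s by rewrite /g -expr2 mulr_ge0 ?sqr_ge0 ?expR_ge0.
have gt k : g k t <= 0 -> f t ^+ 2 <= 0.
  by rewrite /g -expr2 pmulr_lle0 ?expR_gt0.
have [tt|tt] := leP t0 t.
  have [K K0 cK] := continuous_bounded_seg t0 t cc.
  apply: (gt (- (2 * K))); rewrite -(subr0 (g _ t)) -{1}(g0 (- (2 * K))).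
  have [|s ss ->] := MVT_segment tt (fun s _ => gd (- (2 * K)) s); first exact: gC.
  have := cK s ss; rewrite ler_norml => /andP[_ csK].
  apply: mulr_le0_ge0; rewrite ?subr_ge0//; apply: mulr_le0_ge0 => //; lra.
have [K K0 cK] := continuous_bounded_seg t t0 cc.
apply: (gt (2 * K)); rewrite -(opprK (g _ t)) oppr_le0 
  -(add0r (- g _ t)) -{2}(g0 (2 * K)).
have [|s ss ->] := MVT_segment (ltW tt) (fun s _ => gd (2 * K) s); first exact: gC.
have := cK s ss; rewrite ler_norml => /andP[csK _].
apply: mulr_ge0; rewrite ?subr_ge0 ?(ltW tt)//; apply: mulr_ge0 => //; lra.
Qed.

(** A nonpositive value would force a zero by the intermediate value theorem, and a solution with
    one zero vanishes identically. *)
Lemma linear_ode_gt0 c f t0 : continuous c ->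
  (forall t, is_derive t 1 f (c t * f t)) -> 0 < f t0 -> forall t, 0 < f t.
Proof.
move=> cc fd f0 t; rewrite ltNge; apply/negP => ft.
have fC (A : set R) : {within A, continuous f}.
  by apply: continuous_subspaceT; apply: is_derive_continuous fd.
have [s fs] : exists s, f s = 0.
  have [tt|tt] := leP t0 t.
    have [|s _ ?] := IVT (v := 0) tt (fC _); last by exists s.
    by rewrite ge_min ft orbT le_max ltW.
  have [|s _ ?] := IVT (v := 0) (ltW tt) (fC _); last by exists s.
  by rewrite ge_min ft le_max (ltW f0) orbT.
by have := linear_ode_eq0 cc fd fs t0 => f00; move: f0; rewrite f00 ltxx.
Qed.

End Calculus.

(** * Entrywise calculus of matrix-valued functions *)

Section EntrywiseDerivative.
Context {R : realType}.

Definition is_derive_mx m n (X : R -> 'M[R]_(m, n)) (t : R) (dX : 'M[R]_(m, n)) :=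
  forall i j, is_derive t 1 (fun s => X s i j) (dX i j).

Lemma is_derive_mxP m n (X : R -> 'M[R]_(m, n)) (t : R) dX :
  is_derive t 1 X dX -> is_derive_mx X t dX.
Proof.
move=> [Xd XE] i j; apply: DeriveDef; first by move/derivable_mxP: Xd; exact.
by rewrite -XE derive_mx// mxE.
Qed.

Lemma is_derive_mxM m n p (X : R -> 'M[R]_(m, n)) (Y : R -> 'M[R]_(n, p)) t
    dX dY :
  is_derive_mx X t dX -> is_derive_mx Y t dY ->
  is_derive_mx (fun s => X s *m Y s) t (dX *m Y t + X t *m dY).
Proof.
move=> Xd Yd i k.
under [X in is_derive _ _ X]eq_fun do rewrite mxE.
rewrite !mxE -big_split /=; apply: is_derive_sumf => j.
exact: is_deriveMf.
Qed.

Lemma is_derive_mx_unique m n (X : R -> 'M[R]_(m, n)) (t : R) dX dY :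
  is_derive_mx X t dX -> is_derive_mx X t dY -> dX = dY.
Proof.
by move=> d1 d2; apply/matrixP => i j; apply: is_derive_unique (d1 i j) (d2 i j).
Qed.

Definition mx_continuous m n (X : R -> 'M[R]_(m, n)) :=
  forall i j, continuous (fun s => X s i j).

Lemma is_derive_mx_continuous m n (X dX : R -> 'M[R]_(m, n)) :
  (forall t, is_derive_mx X t (dX t)) -> mx_continuous X.
Proof. by move=> Xd i j; apply: is_derive_continuous (fun t => Xd t i j). Qed.

Lemma mx_continuousM m n p (X : R -> 'M[R]_(m, n)) (Y : R -> 'M[R]_(n, p)) :
  mx_continuous X -> mx_continuous Y -> mx_continuous (fun s => X s *m Y s).
Proof.
move=> Xc Yc i k; under [X in continuous X]eq_fun do rewrite mxE.
apply: continuous_big => [|j _ s]; first exact: add_continuous.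
by apply: cvgM; [exact: Xc|exact: Yc].
Qed.

Lemma det_continuous n (X : R -> 'M[R]_n) :
  mx_continuous X -> continuous (fun s => \det (X s)).
Proof.
move=> Xc.
have pc (p : {perm 'I_n}) : continuous (fun s => \prod_i X s i (p i)).
  by apply: continuous_big => [|i _]; [exact: mul_continuous|exact: Xc].
apply: continuous_big => [|p _]; first exact: add_continuous.
by move=> s; apply: cvgM; [exact: cvg_cst|exact: pc].
Qed.

(** By the cofactor formula, each entry of the inverse is a quotient of determinants. *)
Lemma invmx_continuous n (X : R -> 'M[R]_n) :
  (forall s, X s \in unitmx) -> mx_continuous X ->
  mx_continuous (fun s => invmx (X s)).
Proof.
move=> Xu Xc i j.
have -> : (fun s => invmx (X s) i j) =
    (fun s => (\det (X s))^-1 * ((-1) ^+ (j + i) * \det (row' j (col' i (X s))))).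
  by apply/funext => s; rewrite /invmx Xu !mxE.
move=> s; apply: cvgM.
  apply: cvgV; last exact: det_continuous.
  by have := Xu s; rewrite unitmxE unitfE.
apply: cvgM; first exact: cvg_cst.
apply: det_continuous => k l; under [X in continuous X]eq_fun do rewrite !mxE.
exact: Xc.
Qed.

End EntrywiseDerivative.

(** * Spectral theory of the bidiagonal pencil *)

(* The characteristic polynomial det(zM - L) of the leading n x n block. It is
   monic of degree n only when [b 0 = 0], because of the truncated [m.-1] at
   [m = 0]. *)
Fixpoint lop (R : realType) (a b : nat -> R) (n : nat) : {poly R} :=
  if n is m.+1 then
    ('X - (a m.+1)%:P) * lop a b m - (b m)%:P * 'X * lop a b m.-1
  else 1.

Section Pencil.
Context {R : realType}.
Variables (N : nat) (a b : nat -> R).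

Local Notation L := (Lmx N a).
Local Notation M := (Mmx N b).
Local Notation P := (lop a b).

Lemma lop0_horner x : (P 0).[x] = 1.
Proof. by rewrite /= hornerE. Qed.

Lemma lopS_horner n x :
  (P n.+1).[x] = (x - a n.+1) * (P n).[x] - x * b n * (P n.-1).[x].
Proof. by rewrite [P _]/= !hornerE; ring. Qed.

(** Vectors are functions on [nat], so that shifted indices need no bound proofs; the edge of the
    matrix survives only as a conditional. *)
Lemma Lmx_row (f : nat -> R) (i : 'I_N) :
  \sum_(k < N) L i k * f k =
  a i.+1 * f i + (if (i.+1 < N)%N then f i.+1 else 0).
Proof.
under eq_bigr => k _.
  have -> : L i k * f k = (if k == i :> nat then a i.+1 * f k else 0)
                        + (if k == i.+1 :> nat then f k else 0).
    rewrite mxE; case: eqP => [->|_]; first by rewrite ltn_eqF// addr0.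
    by case: eqP; rewrite ?mul1r ?mul0r add0r.
  over.
by rewrite big_split -!big_mkcond /= big_pred1_eq big_ord1_eq.
Qed.

Lemma Lmx_col (f : nat -> R) (j : 'I_N) :
  \sum_(k < N) f k * L k j =
  f j * a j.+1 + (if nat_of_ord j is j'.+1 then f j' else 0).
Proof.
under eq_bigr => k _.
  have -> : f k * L k j = (if k == j :> nat then f k * a j.+1 else 0)
      + (if nat_of_ord j is j'.+1 then if k == j' :> nat then f k else 0 else 0).
    rewrite mxE eq_sym; case: eqP => [->|_].
      case: (nat_of_ord j) => [|j']; rewrite ?addr0//.
      by rewrite gtn_eqF// addr0.
    case: (nat_of_ord j) => [|j']; first by rewrite mulr0 add0r.
    by rewrite eqSS eq_sym; case: eqP; rewrite ?mulr1 ?mulr0 add0r.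
  over.
rewrite big_split -big_mkcond /= big_pred1_eq; congr +%R.
have := ltn_ord j; case: (nat_of_ord j) => [|j'] jN; first by rewrite big1.
by rewrite -big_mkcond big_ord1_eq ltnW.
Qed.

Hypothesis b0 : b 0 = 0.

(** In row 0 the truncated predecessor produces a spurious [b 0 * f 0], removed by [b 0 = 0]. *)
Lemma Mmx_row (f : nat -> R) (i : 'I_N) :
  \sum_(k < N) M i k * f k = f i - b i * f i.-1.
Proof.
under eq_bigr => k _.
  have -> : M i k * f k = (if k == i :> nat then f k else 0)
      - (if nat_of_ord i is i'.+1 then
           if k == i' :> nat then b i'.+1 * f k else 0 else 0).
    rewrite mxE; case: eqP => [->|_].
      case: (nat_of_ord i) => [|i']; rewrite ?mul1r ?subr0//.
      by rewrite gtn_eqF// subr0.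
    case: (nat_of_ord i) => [|i']; first by rewrite mul0r subr0.
    by rewrite eqSS eq_sym; case: eqP => [->|_]; rewrite ?mulNr ?mul0r ?subr0 ?sub0r.
  over.
rewrite sumrB -big_mkcond /= big_pred1_eq; congr (_ - _).
have := ltn_ord i; case: (nat_of_ord i) => [|i'] iN; first by rewrite big1// b0 mul0r.
by rewrite -big_mkcond (big_ord1_eq _ (fun k => b i'.+1 * f k)) ltnW.
Qed.

Hypothesis bN : b N = 0.

Lemma Mmx_col (f : nat -> R) (j : 'I_N) :
  \sum_(k < N) f k * M k j = f j - b j.+1 * f j.+1.
Proof.
under eq_bigr => k _.
  have -> : f k * M k j = (if k == j :> nat then f k else 0)
                        - (if k == j.+1 :> nat then b j.+1 * f k else 0).
    rewrite mxE eq_sym; case: eqP => [->|_].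
      by rewrite ltn_eqF// mulr1 subr0.
    by case: eqP => [->|_]; rewrite ?mulr0 ?subr0// sub0r mulrN mulrC.
  over.
rewrite sumrB -!big_mkcond /= big_pred1_eq; congr (_ - _).
rewrite (big_ord1_eq _ (fun k => b j.+1 * f k)).
case: ltnP => // jN; have <- : N = j.+1 by apply/eqP; rewrite eqn_leq jN ltn_ord.
by rewrite bN mul0r.
Qed.

Lemma lop_monic_size n : P n \is monic /\ size (P n) = n.+1.
Proof.
(* The recurrence looks back two steps, so the induction carries two consecutive indices. *)
suff: (P n \is monic /\ size (P n) = n.+1) /\
      (P n.+1 \is monic /\ size (P n.+1) = n.+2) by case.
elim: n => [|n [IH1 [mn sn]]].
  rewrite /= b0 polyC0 !mul0r subr0 mulr1.
  by rewrite monic1 size_poly1 monicXsubC size_XsubC.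
split=> //; move: IH1 => [mn' sn'].
have mX : ('X - (a n.+2)%:P) * P n.+1 \is monic by rewrite monicMl ?monicXsubC.
have sX : size (('X - (a n.+2)%:P) * P n.+1) = n.+3.
  by rewrite size_Mmonic ?monic_neq0 ?monicXsubC// size_XsubC sn.
have sY : (size (- ((b n.+1)%:P * 'X * P n)) < n.+3)%N.
  rewrite size_polyN -mulrA mul_polyC (leq_ltn_trans (size_scale_leq _ _))//.
  by rewrite mulrC size_mulX ?monic_neq0// sn'.
have -> : P n.+2 = ('X - (a n.+2)%:P) * P n.+1 - (b n.+1)%:P * 'X * P n by [].
split; last by rewrite size_polyDl sX.
by rewrite monicE lead_coefDl ?sX// -monicE.
Qed.

Lemma lop_monic n : P n \is monic. Proof. by case: (lop_monic_size n). Qed.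

Lemma size_lop n : size (P n) = n.+1. Proof. by case: (lop_monic_size n). Qed.

(** Column [i] is the right eigenvector of the pencil for [x i.+1] when this is a root of [P N]. *)
Definition lop_mx (x : nat -> R) : 'M[R]_N := \matrix_(k, i) (P k).[x i.+1].

(** The matrix factors as the coefficient matrix of the [P k], triangular with unit diagonal, times
    a Vandermonde matrix. *)
Lemma lop_mx_unit (x : nat -> R) :
  {in [pred k | (0 < k <= N)%N] &, injective x} -> lop_mx x \in unitmx.
Proof.
move=> xinj.
pose T : 'M[R]_N := \matrix_(k, j) (P k)`_j.
have -> : lop_mx x = T *m Vandermonde N (\row_i x i.+1).
  apply/matrixP => k i; rewrite !mxE (@horner_coef_wide _ N); last first.
    by rewrite size_lop.
  by apply: eq_bigr => j _; rewrite !mxE.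
rewrite unitmx_mul; apply/andP; split; rewrite unitmxE unitfE.
  rewrite det_trig; last first.
    apply/is_trig_mxP => i j ij; rewrite mxE nth_default// size_lop.
    exact: ij.
  rewrite big1 ?oner_eq0// => i _; rewrite mxE.
  by have /monicP := lop_monic i; rewrite lead_coefE size_lop.
rewrite det_Vandermonde; apply/prodf_neq0 => i _; apply/prodf_neq0 => j ij.
rewrite !mxE subr_eq0; apply/eqP => /xinj; rewrite !inE !ltn_ord => /(_ isT isT).
by case=> ji; move: ij; rewrite ji ltnn.
Qed.

Lemma Mlop_mxE x (k i : 'I_N) :
  (M *m lop_mx x) k i = (P k).[x i.+1] - b k * (P k.-1).[x i.+1].
Proof.
rewrite mxE; under eq_bigr do rewrite [lop_mx _ _ _]mxE.
by rewrite (Mmx_row (fun k => (P k).[_])).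
Qed.

Lemma Llop_mxE x (k i : 'I_N) : (P N).[x i.+1] = 0 ->
  (L *m lop_mx x) k i = a k.+1 * (P k).[x i.+1] + (P k.+1).[x i.+1].
Proof.
move=> PN; rewrite mxE; under eq_bigr do rewrite [lop_mx _ _ _]mxE.
rewrite (Lmx_row (fun k => (P k).[_])); case: ltnP => // Nk; congr +%R.
by have <- : N = k.+1 by apply/eqP; rewrite eqn_leq Nk ltn_ord.
Qed.

(** The recurrence for [P] is the eigenvector equation row by row; the last row closes because [P N]
    vanishes at the nodes. *)
Lemma lop_mx_eigen x : (forall i : 'I_N, (P N).[x i.+1] = 0) ->
  L *m lop_mx x = M *m lop_mx x *m diag_mx (\row_i x i.+1).
Proof.
move=> PN; apply/matrixP => k i.
by rewrite mul_mx_diag [RHS]mxE Llop_mxE// Mlop_mxE lopS_horner !mxE; ring.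
Qed.

Lemma Mmx_unit : M \in unitmx.
Proof.
rewrite unitmxE det_trig ?big1 ?unitr1//.
  by move=> i _; rewrite mxE eqxx.
apply/is_trig_mxP => i j ij; rewrite mxE gtn_eqF//.
by rewrite ltn_eqF// (leq_trans ij).
Qed.

(* The tridiagonal pencil zM - L is diagonally symmetrizable, so rescaling its
   right eigenvectors gives left ones. *)
Definition dual_lop (x : R) (l : nat) : R :=
  (P l).[x] / (x ^+ l * \prod_(1 <= j < l.+1) b j).

Definition dual_mx (x : nat -> R) : 'M[R]_N := \matrix_(i, l) dual_lop (x i.+1) l.

Section Positive.
Hypotheses (a_gt0 : forall k, (0 < k <= N)%N -> 0 < a k)
           (b_gt0 : forall k, (0 < k < N)%N -> 0 < b k).

Lemma prod_b_gt0 l : (l < N)%N -> 0 < \prod_(1 <= j < l.+1) b j.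
Proof.
move=> lN; rewrite big_nat_cond; apply: prodr_gt0 => j /andP[/andP[j1 jl] _].
by rewrite b_gt0// j1 (leq_trans jl).
Qed.

Lemma dual_lopS (x : R) l : 0 < x -> (l.+1 < N)%N ->
  x * b l.+1 * dual_lop x l.+1 = (P l.+1).[x] / (x ^+ l * \prod_(1 <= j < l.+1) b j).
Proof.
move=> x0 lN; rewrite /dual_lop big_nat_recr//= exprS.
have := @b_gt0 l.+1 lN; have := prod_b_gt0 (ltnW lN).
move: (\prod_(_ <= _ < _) _) => p p0 b1.
by field; rewrite !gt_eqF// exprn_gt0.
Qed.

(* At [l + 1 = N] both sides vanish. *)
Lemma dual_lopSN (x : R) l : 0 < x -> (P N).[x] = 0 -> (l < N)%N ->
  x * b l.+1 * dual_lop x l.+1 = (P l.+1).[x] / (x ^+ l * \prod_(1 <= j < l.+1) b j).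
Proof.
move=> x0 PN; rewrite leq_eqVlt => /predU1P[lN|]; last exact: dual_lopS.
by rewrite lN bN PN mulr0 !mul0r.
Qed.

Lemma dual_mx_eigen (x : nat -> R) : (forall i : 'I_N, 0 < x i.+1) ->
  (forall i : 'I_N, (P N).[x i.+1] = 0) ->
  dual_mx x *m L = diag_mx (\row_i x i.+1) *m (dual_mx x *m M).
Proof.
move=> x0 PN; apply/matrixP => i l.
have YL : (dual_mx x *m L) i l = dual_lop (x i.+1) l * a l.+1
    + (if nat_of_ord l is l'.+1 then dual_lop (x i.+1) l' else 0).
  rewrite mxE; under eq_bigr do rewrite [dual_mx _ _ _]mxE.
  exact: (Lmx_col (dual_lop _)).
have YM : (dual_mx x *m M) i l =
    dual_lop (x i.+1) l - b l.+1 * dual_lop (x i.+1) l.+1.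
  rewrite mxE; under eq_bigr do rewrite [dual_mx _ _ _]mxE.
  exact: (Mmx_col (dual_lop _)).
rewrite mul_diag_mx [RHS]mxE YL YM {YL YM} mxE.
have E := dual_lopSN (x0 i) (PN i) (ltn_ord l).
rewrite mulrBr (mulrA _ (b _)) E.
rewrite lopS_horner {E}.
have := x0 i; move: (x i.+1) => y y0.
have := ltn_ord l; case: (nat_of_ord l) => [|l'] lN.
  by rewrite /dual_lop b0 /= !hornerE big_geq//; field.
rewrite /dual_lop (@big_nat_recr _ _ _ l'.+1)//= -[_ - _ * _]/(P l'.+1) exprS.
have := @b_gt0 l'.+1 lN; have := prod_b_gt0 (ltnW lN).
move: (\prod_(_ <= _ < _) _) => p p0 b1.
by field; rewrite !gt_eqF// exprn_gt0.
Qed.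

(** The pairing of the left eigenvector with [M] times the right one; its inverse at time 0 is the
    initial weight. *)
Definition lop_norm (x : R) : R :=
  \sum_(l < N) dual_lop x l * ((P l).[x] - b l * (P l.-1).[x]).

(* Writing [x * lop_norm x] once through [x M] and once through [L], the cross
   terms [P_l P_(l+1)] cancel in the sum and only squares remain. *)
Lemma lop_norm_gt0 (x : R) : (0 < N)%N -> 0 < x -> (P N).[x] = 0 -> 0 < lop_norm x.
Proof.
move=> N0 x0 PN.
have E1 : lop_norm x =
    \sum_(l < N) (dual_lop x l - b l.+1 * dual_lop x l.+1) * (P l).[x].
  rewrite /lop_norm.
  under eq_bigr do rewrite -(Mmx_row (fun k => (P k).[x])) mulr_sumr.
  rewrite exchange_big /=; apply: eq_bigr => l _.
  rewrite -(Mmx_col (dual_lop x)) mulr_suml.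
  by apply: eq_bigr => k _; rewrite mulrA.
have E2 : x * lop_norm x = \sum_(l < N)
    (dual_lop x l * (a l.+1 * (P l).[x]) + dual_lop x l * (P l.+1).[x]).
  rewrite /lop_norm mulr_sumr; apply: eq_bigr => l _.
  by rewrite lopS_horner; ring.
suff : 0 < 2 * x * lop_norm x by rewrite pmulr_rgt0// mulr_gt0.
have -> : 2 * x * lop_norm x = \sum_(l < N) (x + a l.+1) * (dual_lop x l * (P l).[x]).
  have -> : 2 * x * lop_norm x = x * lop_norm x + x * lop_norm x by ring.
  rewrite {1}E1 E2 mulr_sumr -big_split /=; apply: eq_bigr => l _.
  rewrite [X in _ = X](_ : _ = x * (dual_lop x l - b l.+1 * dual_lop x l.+1) * (P l).[x]
     + (x * b l.+1 * dual_lop x l.+1) * (P l).[x]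
     + dual_lop x l * (a l.+1 * (P l).[x])); last ring.
  rewrite dual_lopSN// /dual_lop.
  rewrite !invfM.
  ring.
have t0 (l : 'I_N) : 0 <= (x + a l.+1) * (dual_lop x l * (P l).[x]).
  apply: mulr_ge0; first by rewrite addr_ge0 ?(ltW x0)// ltW// a_gt0//=.
  rewrite /dual_lop mulrAC mulr_ge0 -?expr2 ?sqr_ge0//.
  rewrite invr_ge0 mulr_ge0 ?exprn_ge0 ?(ltW x0)//.
  by rewrite ltW// prod_b_gt0.
(* Strictness comes from the term [l = 0], where [P 0 = 1]. *)
rewrite (bigD1 (Ordinal N0))//= ltr_pwDl ?sumr_ge0//.
rewrite /dual_lop /= big_geq//= !(mulr1, expr0, invr1).
by rewrite -polyC1 hornerC !mulr1 addr_gt0 ?a_gt0.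
Qed.

End Positive.
End Pencil.

(** * Biorthogonality of eigenvectors and the discrete measure *)

Section Orthogonality.
Context {R : realType}.
Variables (N : nat) (a b x : nat -> R).
Hypotheses (b0 : b 0 = 0) (bN : b N = 0).
Local Notation L := (Lmx N a).
Local Notation M := (Mmx N b).
Local Notation P := (lop a b).
Local Notation Z := (lop_mx N a b x).
Local Notation Y := (dual_mx N a b x).
Hypotheses (x_gt0 : forall i : 'I_N, 0 < x i.+1)
           (x_inj : {in [pred k | (0 < k <= N)%N] &, injective x})
           (x_root : forall i : 'I_N, (P N).[x i.+1] = 0).
Hypotheses (a_gt0 : forall k, (0 < k <= N)%N -> 0 < a k)
           (b_gt0 : forall k, (0 < k < N)%N -> 0 < b k).

(** [Y L Z] can be evaluated from either side, so [Y M Z] commutes with the diagonal matrix of the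
    distinct eigenvalues and is itself diagonal. *)
Lemma dual_biorthogonal :
  Y *m (M *m Z) = diag_mx (\row_i lop_norm N a b (x i.+1)).
Proof.
apply/matrixP => i j; rewrite !mxE; case: eqP => [<-|ij].
  by rewrite mulr1n; apply: eq_bigr => l _; rewrite Mlop_mxE// mxE.
rewrite mulr0n -[LHS]/(\sum_j0 Y i j0 * (M *m Z) j0 j).
have -> : \sum_k Y i k * (M *m Z) k j = (Y *m (M *m Z)) i j by rewrite [RHS]mxE.
have : diag_mx (\row_i x i.+1) *m (Y *m (M *m Z)) =
    Y *m (M *m Z) *m diag_mx (\row_i x i.+1).
  rewrite -[RHS]mulmxA -lop_mx_eigen// [in RHS]mulmxA dual_mx_eigen//.
  by rewrite !mulmxA.
move/matrixP/(_ i j)/eqP; rewrite mul_diag_mx mul_mx_diag !mxE -subr_eq0.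
rewrite -[\sum_j0 _]/(\sum_j0 Y i j0 * (M *m Z) j0 j).
rewrite [X in _ - X]mulrC -mulrBl mulf_eq0 subr_eq0 => /orP[/eqP xij|/eqP//].
case: ij; apply/val_inj; have := x_inj _ _ xij; rewrite !inE !ltn_ord.
by move=> /(_ isT isT) [].
Qed.

Let N_gt0 (i : 'I_N) : (0 < N)%N. Proof. exact: leq_ltn_trans (ltn_ord i). Qed.

Lemma lop_norm_neq0 i : lop_norm N a b (x (i : 'I_N).+1) != 0.
Proof. by rewrite gt_eqF// lop_norm_gt0// (N_gt0 i). Qed.

(** A one-sided inverse of a square matrix is two-sided. In this order the product sums over the
    eigenvalues, which is what makes it an orthogonality relation for polynomials. *)
Lemma dual_completeness :
  M *m Z *m (diag_mx (\row_i (lop_norm N a b (x i.+1))^-1) *m Y) = 1%:M.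
Proof.
apply: mulmx1C; rewrite -mulmxA dual_biorthogonal.
apply/matrixP => i j; rewrite mul_diag_mx !mxE.
case: eqP => [->|_]; last by rewrite mulr0n mulr0.
by rewrite !mulr1n mulVf// lop_norm_neq0.
Qed.

Lemma dual_lop0 y : dual_lop a b y 0 = 1.
Proof. by rewrite /dual_lop lop0_horner big_geq// expr0 mulr1 divr1. Qed.

(** The first column of the completeness relation: the weights [1 / lop_norm] are sent by [M Z] to
    the first basis vector. At time 0 this is the initial condition for the evolution of the
    weights. *)
Lemma lop_quadrature0 (k : 'I_N) :
  \sum_(i < N) (M *m Z) k i / lop_norm N a b (x i.+1) = (k == 0 :> nat)%:R.
Proof.
have k0 := N_gt0 k.
have /matrixP/(_ k (Ordinal k0)) := dual_completeness.
rewrite mxE [RHS]mxE => H; rewrite -[RHS]H; apply: eq_bigr => i _.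
by rewrite mul_diag_mx !mxE dual_lop0 mulr1.
Qed.

(* A weight with [M Z w] proportional to the first basis vector is
   proportional to [1 / lop_norm]. *)
Lemma lop_orthogonal (w : 'cV[R]_N) (k l : 'I_N) :
  (forall i, w i 0 != 0) ->
  (forall j : 'I_N, (j : nat) != 0 -> (M *m Z *m w) j 0 = 0) ->
  k != l ->
  \sum_(i < N) w i 0 / x i.+1 ^+ l *
    ((P k).[x i.+1] - b k * (P k.-1).[x i.+1]) * (P l).[x i.+1] = 0.
Proof.
move=> w0 Mw kl; have N0 := N_gt0 k.
set r := (M *m Z *m w) (Ordinal N0) 0.
(* Apply [Y] to [M Z w]: the left side becomes diagonal, and on the right only the first column of
   [Y], which is constantly 1, contributes. *)
have wE (i : 'I_N) : lop_norm N a b (x i.+1) * w i 0 = r.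
  have : (Y *m (M *m Z) *m w) i 0 = r.
    rewrite -mulmxA mxE (bigD1 (Ordinal N0))//= mxE dual_lop0 mul1r.
    by rewrite big1 ?addr0// => j j0; rewrite Mw ?mulr0.
  by rewrite dual_biorthogonal mul_diag_mx !mxE.
have /matrixP/(_ k l) := dual_completeness.
rewrite mxE [RHS]mxE (negbTE kl) mulr0n => H.
have r0 : r != 0 by rewrite -(wE k) mulf_neq0// lop_norm_neq0.
pose pb := \prod_(1 <= j < l.+1) b j.
have pb0 : pb != 0 by rewrite gt_eqF// (prod_b_gt0 b_gt0).
rewrite -[LHS]mul1r -(divff (mulf_neq0 r0 pb0)) -mulrA.
rewrite -[RHS](mulr0 (r * pb)) -{2}H; congr (_ * _).
rewrite mulr_sumr; apply: eq_bigr => i _.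
rewrite mul_diag_mx Mlop_mxE// !mxE /dual_lop -/pb.
rewrite -(wE i); have := lop_norm_neq0 i; have := w0 i; have := x_gt0 i.
move: (x _) (w i 0) (lop_norm _ _ _ _) => y wi ni y0 wi0 ni0.
by field; rewrite pb0 wi0 ni0 expf_neq0// gt_eqF.
Qed.

End Orthogonality.

(** * Least-squares characterization of the orthogonal polynomials *)

Section Extremality.
Context {R : realType}.
Variables (N : nat) (a b : nat -> R).
Hypothesis (b0 : b 0 = 0).
Local Notation P := (lop a b).

(** Pythagoras: [Q - P l] has degree less than [l], hence is orthogonal to [P l]. The hypothesis
    concerns the combinations [P k - b k P k.-1], the form in which completeness delivers
    orthogonality. *)
Lemma lop_extremal (y c : 'I_N -> R) l (Q : {poly R}) :
  (forall i, 0 <= c i) ->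
  (forall k, (k < l)%N ->
    \sum_i c i * ((P k).[y i] - b k * (P k.-1).[y i]) * (P l).[y i] = 0) ->
  Q \is monic -> size Q = l.+1 ->
  \sum_i c i * (P l).[y i] ^+ 2 <= \sum_i c i * Q.[y i] ^+ 2.
Proof.
move=> c0 orth Qm Qs.
(* The combinations are undone by induction, starting from [b 0 = 0]. *)
have orthP k : (k < l)%N -> \sum_i c i * (P k).[y i] * (P l).[y i] = 0.
  elim: k => [|k IH] kl; have H := orth _ kl.
    by rewrite -[RHS]H; apply: eq_bigr => i _; rewrite b0 mul0r subr0.
  apply: (etrans (y := \sum_i c i * ((P k.+1).[y i] - b k.+1 * (P k).[y i]) *
      (P l).[y i] + b k.+1 * \sum_i c i * (P k).[y i] * (P l).[y i])).
    by rewrite mulr_sumr -big_split; apply: eq_bigr => i _ /=; ring.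
  by rewrite H IH ?mulr0 ?addr0// ltnW.
(* Each step removes the top coefficient of [p] with a multiple of the monic [P k]. *)
have orthp k (p : {poly R}) : (k <= l)%N -> (size p <= k)%N ->
    \sum_i c i * p.[y i] * (P l).[y i] = 0.
  elim: k p => [|k IH] p kl sp.
    move: sp; rewrite leqn0 size_poly_eq0 => /eqP ->.
    by rewrite big1// => i _; rewrite horner0 mulr0 mul0r.
  have sq : (size (p - p`_k *: P k)%R <= k)%N.
    apply/leq_sizeP => j; rewrite leq_eqVlt => /predU1P[<-|kj].
      have /monicP := lop_monic a b0 k; rewrite lead_coefE size_lop//= => Pk.
      by rewrite coefB coefZ Pk mulr1 subrr.
    rewrite coefB coefZ (nth_default _ (leq_trans sp kj)) [X in _ * X]nth_default.
      by rewrite mulr0 subr0.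
    by rewrite size_lop.
  apply: (etrans (y := \sum_i c i * (p - p`_k *: P k).[y i] * (P l).[y i] +
      p`_k * \sum_i c i * (P k).[y i] * (P l).[y i])).
    rewrite mulr_sumr -big_split; apply: eq_bigr => i _ /=.
    by rewrite hornerD hornerN hornerZ; ring.
  by rewrite orthP// IH ?mulr0 ?addr0// ltnW.
have sD : (size (Q - P l)%R <= l)%N.
  apply/leq_sizeP => j; rewrite leq_eqVlt => /predU1P[<-|lj].
    have /monicP := lop_monic a b0 l; rewrite lead_coefE size_lop//= => Pl.
    by move/monicP: Qm; rewrite lead_coefE Qs coefB /= => ->; rewrite Pl subrr.
  by rewrite coefB !nth_default ?subrr ?Qs ?size_lop.
have H := orthp l _ (leqnn l) sD.
have -> : \sum_i c i * Q.[y i] ^+ 2 = \sum_i c i * (P l).[y i] ^+ 2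
    + \sum_i c i * (Q - P l).[y i] ^+ 2.
  apply: (etrans (y := \sum_i (c i * (P l).[y i] ^+ 2 + c i * (Q - P l).[y i] ^+ 2) +
      2 * \sum_i c i * (Q - P l).[y i] * (P l).[y i])).
    rewrite mulr_sumr -big_split; apply: eq_bigr => i _ /=.
    by rewrite hornerD hornerN; ring.
  by rewrite H mulr0 addr0 big_split.
by rewrite lerDl; apply: sumr_ge0 => i _; rewrite mulr_ge0// sqr_ge0.
Qed.

End Extremality.

(** * Generalized eigenvalues are roots of the characteristic polynomial *)

Section EigenRoot.
Context {R : realType}.

Definition vec_nth N (u : 'cV[R]_N) (k : nat) : R :=
  if insub k is Some i then u (i : 'I_N) 0 else 0.

Lemma vec_nthE N (u : 'cV[R]_N) (i : 'I_N) : vec_nth u i = u i 0.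
Proof. by rewrite /vec_nth valK. Qed.

Lemma pencil_row N (a b : nat -> R) x (u : 'cV[R]_N) (k : 'I_N) : b 0 = 0 ->
  ((Lmx N a - x *: Mmx N b) *m u) k 0 =
  a k.+1 * vec_nth u k + (if (k.+1 < N)%N then vec_nth u k.+1 else 0)
  - x * (vec_nth u k - b k * vec_nth u k.-1).
Proof.
move=> b0; rewrite mulmxBl -scalemxAl [LHS]mxE [X in _ + X]mxE [X in - X]mxE.
rewrite !mxE -Lmx_row -(Mmx_row b0).
by congr (_ - _ * _); apply: eq_bigr => j _; rewrite vec_nthE.
Qed.

(** All rows but the last force the eigenvector to be its first component times [P k] at [x]. That
    component is nonzero, and the last row says that it annihilates [P N] at [x]. *)
Lemma gen_eigenvalue_root N (a b : nat -> R) x : (0 < N)%N -> b 0 = 0 ->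
  gen_eigenvalue (Lmx N a) (Mmx N b) x -> (lop a b N).[x] = 0.
Proof.
move=> N0 b0 [u u0 Lu].
have row (k : 'I_N) : ((Lmx N a - x *: Mmx N b) *m u) k 0 = 0.
  by rewrite mulmxBl -scalemxAl Lu subrr mxE.
pose f := vec_nth u; pose g k := f 0 * (lop a b k).[x].
have fE k : (k < N)%N -> f k = g k.
  suff: (k < N)%N -> f k = g k /\ f k.-1 = g k.-1 by move=> + kN => /(_ kN)[].
  elim: k => [_|k IH kN]; first by rewrite /g lop0_horner mulr1.
  have [fk fk1] := IH (ltnW kN); split=> //.
  have := row (Ordinal (ltnW kN)); rewrite pencil_row//= kN -/f fk fk1.
  rewrite /g lopS_horner => H; apply: subr0_eq.
  by rewrite -[RHS]H; ring.
have : f 0 * (lop a b N).[x] = 0.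
  case: N N0 u u0 Lu row @f @g fE => // n _ u u0 _ row f g fE.
  have := row ord_max; rewrite pencil_row//= ltnn -/f (fE n)// (fE n.-1);
    last by rewrite (leq_ltn_trans (leq_pred _)).
  rewrite /g lopS_horner => H; apply: oppr_inj.
  by rewrite oppr0 -[RHS]H; ring.
move/eqP; rewrite mulf_eq0 => /orP[/eqP f0|/eqP//].
case/eqP: u0; apply/matrixP => i j.
by rewrite ord1 mxE -vec_nthE -/f fE// /g f0 mul0r.
Qed.

End EigenRoot.

(** * The flow *)

Lemma strict_lower_col_max (R : realType) n (X : 'M[R]_n) i (j : 'I_n) :
  n = j.+1 -> strict_lower X i j = 0.
Proof. by move=> nj; rewrite mxE ltnNge -ltnS -nj ltn_ord. Qed.

Lemma strict_lower_row0 (R : realType) n (X : 'M[R]_n) (i : 'I_n) j :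
  i = 0 :> nat -> strict_lower X i j = 0.
Proof. by move=> i0; rewrite mxE i0 ltn0. Qed.

(** Since [G L = L H], the strictly lower parts can be traded for the complementary upper triangular
    ones. As [L] is upper triangular too, diagonal entries multiply, and the flow of [a] becomes a
    scalar linear equation. *)
Lemma Lmx_flow_diag (R : realType) N (a : nat -> R) (G H : 'M[R]_N) (i : 'I_N) :
  G *m Lmx N a = Lmx N a *m H ->
  (strict_lower G *m Lmx N a - Lmx N a *m strict_lower H) i i =
  (H i i - G i i) * a i.+1.
Proof.
move=> GH.
have -> : strict_lower G *m Lmx N a - Lmx N a *m strict_lower H =
    Lmx N a *m (H - strict_lower H) - (G - strict_lower G) *m Lmx N a.
  by rewrite mulmxBr mulmxBl GH opprB [RHS]addrC [RHS]addrA subrK.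
rewrite [LHS]mxE [X in _ + X]mxE.
have -> : (Lmx N a *m (H - strict_lower H)) i i = a i.+1 * H i i.
  rewrite mxE (bigD1 i)//= big1 ?addr0 => [|k ki].
    by rewrite !mxE eqxx ltnn subr0.
  case: (ltngtP k i) ki => [lt_ki _|lt_ik _|/val_inj ->]; last by rewrite eqxx.
    by rewrite !mxE (ltn_eqF lt_ki) (ltn_eqF (leqW lt_ki)) mul0r.
  by rewrite !mxE lt_ik subrr mulr0.
suff -> : ((G - strict_lower G) *m Lmx N a) i i = G i i * a i.+1 by ring.
rewrite mxE (bigD1 i)//= big1 ?addr0 => [|k ki].
  by rewrite !mxE eqxx ltnn subr0.
case: (ltngtP k i) ki => [lt_ki _|lt_ik _|/val_inj ->]; last by rewrite eqxx.
  by rewrite !mxE lt_ki subrr mul0r.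
by rewrite !mxE (ltn_eqF lt_ik) (ltn_eqF (leqW lt_ik)) mulr0.
Qed.

(** The same trade for [M]: multiplying a lower bidiagonal matrix by an upper triangular one leaves
    a single term on the subdiagonal. *)
Lemma Mmx_flow_subdiag (R : realType) N (b : nat -> R) (G H : 'M[R]_N)
    (i j : 'I_N) : i = j.+1 :> nat ->
  G *m Mmx N b = Mmx N b *m H ->
  (strict_lower G *m Mmx N b - Mmx N b *m strict_lower H) i j =
  - ((H j j - G i i) * b j.+1).
Proof.
move=> ij GH.
have -> : strict_lower G *m Mmx N b - Mmx N b *m strict_lower H =
    Mmx N b *m (H - strict_lower H) - (G - strict_lower G) *m Mmx N b.
  by rewrite mulmxBr mulmxBl GH opprB [RHS]addrC [RHS]addrA subrK.
rewrite [LHS]mxE [X in _ + X]mxE.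
have -> : (Mmx N b *m (H - strict_lower H)) i j = - b j.+1 * H j j.
  rewrite mxE (bigD1 j)//= big1 ?addr0 => [|k kj].
    by rewrite !mxE ij eqxx ltn_eqF// ltnn subr0.
  case: (ltngtP k j) kj => [lt_kj _|lt_jk _|/val_inj ->]; last by rewrite eqxx.
    by rewrite !mxE ij eqSS (gtn_eqF lt_kj) (ltn_eqF (leqW lt_kj)) mul0r.
  by rewrite !mxE lt_jk subrr mulr0.
suff -> : ((G - strict_lower G) *m Mmx N b) i j = - G i i * b j.+1 by ring.
rewrite mxE (bigD1 i)//= big1 ?addr0 => [|k ki].
  by rewrite !mxE ij eqxx ltn_eqF// !ltnn subr0 mulrN mulNr.
case: (ltngtP k i) ki => [lt_ki _|lt_ik _|/val_inj ->]; last by rewrite eqxx.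
  by rewrite !mxE lt_ki subrr mul0r.
have lt_jk : (j.+1 < k)%N by rewrite -ij.
by rewrite !mxE (ltn_eqF (ltnW lt_jk)) (gtn_eqF lt_jk) mulr0.
Qed.

(** * Motion of the eigenvectors and invariance of the spectrum *)

Section PencilFlow.
Context {R : realType}.
Variables (N : nat) (a b : nat -> R -> R) (G H : R -> 'M[R]_N).
Hypothesis (b0 : forall t, b 0%N t = 0) (bN : forall t, b N t = 0).
Local Notation L t := (Lmx N (a ^~ t)).
Local Notation M t := (Mmx N (b ^~ t)).
Local Notation P t := (lop (a ^~ t) (b ^~ t)).
Local Notation A t := (strict_lower (G t)).
Local Notation B t := (strict_lower (H t)).
Hypothesis Ld : forall t,
  is_derive_mx (fun s => L s) t (A t *m L t - L t *m B t).
Hypothesis Md : forall t,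
  is_derive_mx (fun s => M s) t (A t *m M t - M t *m B t).

Lemma a_is_derive (t : R) (i : 'I_N) :
  is_derive t 1 (a i.+1) ((A t *m L t - L t *m B t) i i).
Proof.
suff -> : a i.+1 = (fun s => L s i i) by exact: Ld.
by apply/funext => s; rewrite mxE eqxx.
Qed.

Lemma b_is_derive (t : R) (i j : 'I_N) : i = j.+1 :> nat ->
  is_derive t 1 (b j.+1) (- (A t *m M t - M t *m B t) i j).
Proof.
move=> ij; suff -> : b j.+1 = (fun s => 0 - M s i j).
  by rewrite -sub0r; exact: (is_deriveBf (is_derive_cstf 0 t) (Md t i j)).
by apply/funext => s; rewrite mxE ij eqxx ltn_eqF// sub0r opprK.
Qed.

Lemma a_derivable (t : R) k : (0 < k <= N)%N -> derivable (a k) t 1.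
Proof. by case: k => // k kN; case: (a_is_derive t (Ordinal (kN : (k < N)%N))). Qed.

Lemma b_derivable (t : R) k : (k <= N)%N -> derivable (b k) t 1.
Proof.
have cst f : (forall s, f s = 0) -> derivable f t (1 : R).
  by move=> f0; have -> : f = cst 0 by [apply/funext|]; exact: derivable_cst.
case: k => [_|k]; first exact: cst.
rewrite leq_eqVlt => /predU1P[->|kN]; first exact: cst.
by have [] := @b_is_derive t (Ordinal kN) (Ordinal (ltnW kN)) erefl.
Qed.

Lemma lop_derivable (x t : R) k : (k <= N)%N -> derivable (fun s => (P s k).[x]) t 1.
Proof.
suff : (k <= N)%N -> derivable (fun s => (P s k).[x]) t 1 /\
    derivable (fun s => (P s k.-1).[x]) t 1 by move=> + kN => /(_ kN)[].
elim: k => [_|k IH kN].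
  have -> : (fun s => (P s 0).[x]) = cst 1.
    by apply/funext => s; rewrite lop0_horner.
  by split; exact: derivable_cst.
have [Pk Pk1] := IH (ltnW kN); split; last exact: Pk.
have da := @a_derivable t k.+1 kN; have db := @b_derivable t k (ltnW kN).
have -> : (fun s => (P s k.+1).[x]) = (cst x - a k.+1) * (fun s => (P s k).[x])
    - cst x * b k * (fun s => (P s k.-1).[x]).
  by apply/funext => s; rewrite lopS_horner.
have cx : derivable (cst x : R -> R) t 1 by exact: derivable_cst.
exact: (derivableB (derivableM (derivableB cx da) Pk)
  (derivableM (derivableM cx db) Pk1)).
Qed.

Definition lop_col x t : 'cV[R]_N := \col_k (P t k).[x].

Lemma pencil_lop_col x s : ((L s - x *: M s) *m lop_col x s) =
  \col_k (if k.+1 == N then - (P s N).[x] else 0).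
Proof.
apply/matrixP => k j; rewrite ord1 pencil_row// [RHS]mxE.
have fE l : (l < N)%N -> vec_nth (lop_col x s) l = (P s l).[x].
  by move=> lN; rewrite -[l]/(val (Ordinal lN)) vec_nthE mxE.
rewrite (fE k)// (fE k.-1) ?(leq_ltn_trans (leq_pred _))//.
case: ltnP => kN; first by rewrite ltn_eqF// fE// lopS_horner; ring.
have Nk : N = k.+1 by apply/eqP; rewrite eqn_leq kN ltn_ord.
have -> : P s N = P s k.+1 by rewrite -Nk.
have -> : (k.+1 == N) by rewrite -Nk.
by rewrite lopS_horner; ring.
Qed.

(* The last row of the pencil applied to [lop_col] is the characteristic
   polynomial; [A] kills the last basis vector and [B] preserves first
   components, so both claims come from one triangular system. *)
Lemma lop_flow (x t : R) :
  is_derive_mx (lop_col x) t (B t *m lop_col x t) /\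
  is_derive t 1 (fun s => (P s N).[x]) 0.
Proof.
case: (posnP N) => N0.
  split; first by move=> i; exfalso;
    have := leq_ltn_trans (leq0n i) (ltn_ord i); rewrite N0.
  rewrite N0; have -> : (fun s => (P s 0).[x]) = cst 1.
    by apply/funext => s; rewrite lop0_horner.
  exact: is_derive_cst.
pose d k := 'D_1 (fun s => (P s k).[x]) t.
have dP k : (k <= N)%N -> is_derive t 1 (fun s => (P s k).[x]) (d k).
  by move=> kN; apply: DeriveDef => //; exact: lop_derivable.
pose D : 'cV[R]_N := \col_k d k.
have zD : is_derive_mx (lop_col x) t D.
  move=> k j; under [X in is_derive _ _ X]eq_fun do rewrite mxE.
  by rewrite mxE; exact/dP/ltnW.
pose W s := L s - x *: M s.
have WD : is_derive_mx W t (A t *m W t - W t *m B t).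
  move=> i j.
  have -> : (fun s => W s i j) = (fun s => L s i j - x * M s i j).
    by apply/funext => s; rewrite /W !mxE.
  apply: (@is_derive_eq _ _ _ _ _ _ _ _ (is_deriveBf (Ld t i j)
    (is_deriveMf (is_derive_cstf x t) (Md t i j)))).
  rewrite mul0r add0r /W mulmxBl mulmxBr -!scalemxAr -!scalemxAl.
  move: (A t *m L t) (A t *m M t) (L t *m B t) (M t *m B t) => X1 X2 X3 X4.
  by rewrite !mxE; ring.
have WzD := is_derive_mxM WD zD.
have WzE : (fun s => W s *m lop_col x s) =
    (fun s => \col_k (if k.+1 == N then - (P s N).[x] else 0)).
  by apply/funext => s; exact: pencil_lop_col.
have WzD' : is_derive_mx (fun s => W s *m lop_col x s) t
    (\col_k (if k.+1 == N then - d N else 0)).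
  rewrite WzE => k j; under [X in is_derive _ _ X]eq_fun do rewrite mxE.
  rewrite mxE; case: eqP => _; last exact: is_derive_cstf.
  suff -> : (fun s => - (P s N).[x]) = (fun s => 0 - (P s N).[x]).
    rewrite -[- d N]sub0r.
    exact: (is_deriveBf (is_derive_cstf 0 t) (dP N (leqnn N))).
  by apply/funext => s; rewrite sub0r.
have := is_derive_mx_unique WzD WzD'; rewrite mulmxBl -!mulmxA.
have -> : A t *m (W t *m lop_col x t) = 0.
  rewrite pencil_lop_col; apply/matrixP => i j; rewrite !mxE.
  apply: big1 => k _; rewrite [X in _ * X]mxE; case: eqP => [kN|_].
    by rewrite strict_lower_col_max ?mul0r.
  by rewrite mulr0.
rewrite sub0r addrC -mulmxBr.
(* [W u] is supported on the last row and [u] has first component 0. The other rows propagate this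
   zero through [u], and the last row then gives [d N = 0]. *)
set u := D - _ => Wu.
have row (k : 'I_N) : (W t *m u) k 0 = if k.+1 == N then - d N else 0.
  by rewrite Wu mxE.
have d0 : d 0 = 0.
  rewrite /d; have -> : (fun s => (P s 0).[x]) = cst 1.
    by apply/funext => s; rewrite lop0_horner.
  exact: derive_cst.
have u0 : vec_nth u 0 = 0.
  rewrite -[0%N]/(val (Ordinal N0)) vec_nthE !mxE d0 big1 ?subrr// => k _.
  by rewrite strict_lower_row0 ?mul0r.
have uE k : (k < N)%N -> vec_nth u k = 0.
  suff: (k < N)%N -> vec_nth u k = 0 /\ vec_nth u k.-1 = 0.
    by move=> + kN => /(_ kN)[].
  elim: k => [_|k IH kN]; first by [].
  have [uk uk1] := IH (ltnW kN); split; last exact: uk.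
  have := row (Ordinal (ltnW kN)).
  by rewrite pencil_row//= kN uk uk1 ltn_eqF// !(mulr0, add0r, oppr0, addr0).
have u00 : u = 0.
  by apply/matrixP => i j; rewrite ord1 -vec_nthE uE// mxE.
have dN0 : d N = 0.
  have iN : (N.-1 < N)%N by rewrite prednK.
  have := row (Ordinal iN); rewrite u00 mulmx0 mxE /= prednK// eqxx.
  by move/esym/eqP; rewrite oppr_eq0 => /eqP.
split; last by rewrite -dN0; exact: dP.
by move/subr0_eq: u00 => <-.
Qed.

Lemma lop_char_const (x s t : R) : (P s N).[x] = (P t N).[x].
Proof.
exact: (is_derive_0_is_cst _ _ (fun r => proj2 (lop_flow x r))).
Qed.

End PencilFlow.

(** * Positivity and weights along the Toda flow *)

Section TodaFlow.
Context {R : realType}.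
Variables (N : nat) (F : R -> R) (a b : nat -> R -> R) (x : nat -> R).
Local Notation L t := (Lmx N (a ^~ t)).
Local Notation M t := (Mmx N (b ^~ t)).
Local Notation P t := (lop (a ^~ t) (b ^~ t)).
Local Notation Z t := (lop_mx N (a ^~ t) (b ^~ t) x).
Local Notation D := (diag_mx (\row_(i < N) x i.+1)).
Local Notation FD := (diag_mx (\row_(i < N) F (x i.+1))).
Local Notation G t := (mxfun F (L t *m invmx (M t))).
Local Notation H t := (mxfun F (invmx (M t) *m L t)).
Local Notation A t := (strict_lower (G t)).
Local Notation B t := (strict_lower (H t)).

Hypotheses (N_gt0 : (0 < N)%N)
  (sol : toda_solution F (fun t => L t) (fun t => M t))
  (a_pos : forall k, (1 <= k <= N)%N -> 0 < a k 0)
  (b_pos : forall k, (1 <= k < N)%N -> 0 < b k 0)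
  (b0 : forall t, b 0%N t = 0)
  (bN : forall t, b N t = 0)
  (x_pos : forall k, (1 <= k <= N)%N -> 0 < x k)
  (x_inj : {in [pred k | (0 < k <= N)%N] &, injective x})
  (x_eig : forall k, (1 <= k <= N)%N -> gen_eigenvalue (L 0) (M 0) (x k)).

Let Ld t : is_derive_mx (fun s => L s) t (A t *m L t - L t *m B t).
Proof. by apply: is_derive_mxP; case: (sol t). Qed.

Let Md t : is_derive_mx (fun s => M s) t (A t *m M t - M t *m B t).
Proof. by apply: is_derive_mxP; case: (sol t). Qed.

Let x_gt0 (i : 'I_N) : 0 < x i.+1. Proof. by apply: x_pos; rewrite /= ltn_ord. Qed.

Lemma toda_root t (k : nat) : (1 <= k <= N)%N -> (P t N).[x k] = 0.
Proof.
move=> kN; rewrite (lop_char_const b0 bN Ld Md _ t 0).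
exact: gen_eigenvalue_root (x_eig kN).
Qed.

Let root t (i : 'I_N) : (P t N).[x i.+1] = 0.
Proof. by apply: toda_root; rewrite /= ltn_ord. Qed.

Let Zu t : Z t \in unitmx. Proof. exact: lop_mx_unit. Qed.
Let Mu t : M t \in unitmx. Proof. exact: Mmx_unit. Qed.
Let MZu t : M t *m Z t \in unitmx. Proof. by rewrite unitmx_mul Mu Zu. Qed.
Let LZ t : L t *m Z t = M t *m Z t *m D. Proof. exact: lop_mx_eigen. Qed.

(** The columns of [M Z] are eigenvectors of [L M^-1] with eigenvalues fixed in time, so [F] enters
    only through the constant matrix [FD]. *)
Lemma mxfun_LM t : G t = M t *m Z t *m FD *m invmx (M t *m Z t).
Proof.
have -> : L t *m invmx (M t) = M t *m Z t *m D *m invmx (M t *m Z t).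
  by rewrite -LZ -[LHS](mulmxK (MZu t)) !mulmxA (mulmxKV (Mu t)).
rewrite mxfunE// => [|i]; last by rewrite mxE.
by congr (_ *m diag_mx _ *m _); apply/rowP => i; rewrite !mxE.
Qed.

Lemma mxfun_ML t : H t = Z t *m FD *m invmx (Z t).
Proof.
have -> : invmx (M t) *m L t = Z t *m D *m invmx (Z t).
  rewrite -[LHS](mulmxK (Zu t)); congr (_ *m _).
  by rewrite -mulmxA LZ !mulmxA (mulVmx (Mu t)) mul1mx.
rewrite mxfunE// => [|i]; last by rewrite mxE.
by congr (_ *m diag_mx _ *m _); apply/rowP => i; rewrite !mxE.
Qed.

Let GMZ t : G t *m (M t *m Z t) = M t *m Z t *m FD.
Proof. by rewrite mxfun_LM mulmxKV. Qed.

Let HZ t : H t *m Z t = Z t *m FD.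
Proof. by rewrite mxfun_ML mulmxKV. Qed.

Let GM t : G t *m M t = M t *m H t.
Proof. by apply: (can_inj (mulmxK (Zu t))); rewrite -!mulmxA GMZ HZ mulmxA. Qed.

Let GL t : G t *m L t = L t *m H t.
Proof.
apply: (can_inj (mulmxK (Zu t))).
rewrite -[LHS]mulmxA LZ [LHS]mulmxA GMZ -[LHS]mulmxA diag_mxC [LHS]mulmxA -LZ.
by rewrite -[RHS]mulmxA HZ [RHS]mulmxA.
Qed.

Let Mc : mx_continuous (fun t => M t).
Proof. exact: is_derive_mx_continuous Md. Qed.

Let Zc : mx_continuous (fun t => Z t).
Proof.
move=> k i; have -> : (fun t => Z t k i) = (fun t => (P t k).[x i.+1]).
  by apply/funext => t; rewrite mxE.
move=> t; apply: differentiable_continuous; apply/derivable1_diffP.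
by apply: (lop_derivable b0 bN Ld Md); exact/ltnW/ltn_ord.
Qed.

Let cstc (X : 'M[R]_N) : mx_continuous (fun _ : R => X).
Proof. by move=> i j t; exact: cvg_cst. Qed.

Let Gc : mx_continuous (fun t => G t).
Proof.
have -> : (fun t => G t) = (fun t => M t *m Z t *m FD *m invmx (M t *m Z t)).
  by apply/funext => t; exact: mxfun_LM.
apply: mx_continuousM; last exact: invmx_continuous (mx_continuousM Mc Zc).
exact: mx_continuousM (mx_continuousM Mc Zc) (@cstc _).
Qed.

Let Hc : mx_continuous (fun t => H t).
Proof.
have -> : (fun t => H t) = (fun t => Z t *m FD *m invmx (Z t)).
  by apply/funext => t; exact: mxfun_ML.
apply: mx_continuousM; last exact: invmx_continuous Zc.
exact: mx_continuousM Zc (@cstc _).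
Qed.

Let HGc i j k l : continuous (fun t => H t i j - G t k l).
Proof. by move=> t; apply: cvgB; [exact: Hc|exact: Gc]. Qed.

(** The logarithmic derivative is the difference of diagonal entries of [H] and [G], which is
    continuous in time. *)
Lemma toda_a_gt0 t k : (1 <= k <= N)%N -> 0 < a k t.
Proof.
case: k => // k kN; pose i := Ordinal (kN : (k < N)%N).
apply: (@linear_ode_gt0 R (fun t => H t i i - G t i i) _ 0) => [|s|].
- exact: HGc.
- by rewrite -(Lmx_flow_diag _ (GL s)); exact: (a_is_derive Ld s i).
- exact: a_pos.
Qed.

Lemma toda_b_gt0 t k : (1 <= k < N)%N -> 0 < b k t.
Proof.
case: k => // k kN; pose i := Ordinal (kN : (k.+1 < N)%N).
pose j := Ordinal (ltnW kN : (k < N)%N).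
apply: (@linear_ode_gt0 R (fun t => H t j j - G t i i) _ 0) => [|s|].
- exact: HGc.
- have := b_is_derive Md s (erefl : i = j.+1 :> nat).
  by rewrite (Mmx_flow_subdiag (erefl : i = j.+1 :> nat) (GM s)) opprK.
- exact: b_pos.
Qed.

(** A common time-dependent factor is left out, since orthogonality is homogeneous in the
    weights. *)
Definition toda_weight (i : 'I_N) (t : R) : R :=
  (lop_norm N (a ^~ 0) (b ^~ 0) (x i.+1))^-1 * expR (- F (x i.+1) * t).

Lemma toda_weight_gt0 i t : 0 < toda_weight i t.
Proof.
by rewrite mulr_gt0 ?expR_gt0// invr_gt0 lop_norm_gt0// => k; exact: toda_b_gt0.
Qed.

Definition toda_weights t : 'cV[R]_N := \col_i toda_weight i t.

(* [q = M Z w] satisfies [q' = - (upper triangular part of F(L M^-1)) q] and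
   [q 0] is the first basis vector, so only the first entry of [q] survives. *)
Lemma toda_weights_e1 t (j : 'I_N) : (j : nat) != 0 ->
  (M t *m Z t *m toda_weights t) j 0 = 0.
Proof.
pose q s := M s *m Z s *m toda_weights s.
have Zd s : is_derive_mx (fun s => Z s) s (B s *m Z s).
  move=> k i; have := (lop_flow b0 bN Ld Md (x i.+1) s).1 k 0.
  have -> : (fun r => lop_col N a b (x i.+1) r k 0) = (fun r => Z r k i).
    by apply/funext => r; rewrite !mxE.
  by congr is_derive; rewrite !mxE; apply: eq_bigr => l _; rewrite !mxE.
have wd s : is_derive_mx toda_weights s (- (FD *m toda_weights s)).
  move=> i k; have := is_deriveMf (is_derive_cstf
    (lop_norm N (a ^~ 0) (b ^~ 0) (x i.+1))^-1 s) (is_derive_expRM (- F (x i.+1)) s).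
  have -> : (fun r => toda_weights r i k) = toda_weight i.
    by apply/funext => r; rewrite !mxE.
  move=> wd; apply: is_derive_eq wd _.
  by rewrite mul0r add0r mul_diag_mx !mxE /toda_weight; ring.
have qd s : is_derive_mx q s (A s *m q s - G s *m q s).
  have := is_derive_mxM (is_derive_mxM (Md s) (Zd s)) (wd s).
  (* The two [B] terms cancel, and the decay of the weights contributes [- G q] because [M Z]
     diagonalizes [G]. *)
  suff -> : (A s *m M s - M s *m B s) *m Z s + M s *m (B s *m Z s) = A s *m (M s *m Z s).
    by rewrite mulmxN [in X in _ - X]mulmxA -GMZ /q !mulmxA.
  by rewrite mulmxBl -!mulmxA subrK.
have q0 k : (k : 'I_N) != 0 :> nat -> q 0 k 0 = 0.
  move=> k0; have := lop_quadrature0 (b0 0) (bN 0) x_gt0 x_inj (root 0) a_pos b_pos k.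
  rewrite (negbTE k0) /q mxE => qk; rewrite -[RHS]qk.
  apply: eq_bigr => i _; rewrite [X in _ * X]mxE /toda_weight mulr0 expR0 mulr1.
  by [].
(* Row [k] of the upper triangular system involves only entries of index at least [k], so the
   induction runs upward from the last row. *)
have qk n : forall k : 'I_N, (k : nat) != 0 -> (N - k <= n)%N -> forall s, q s k 0 = 0.
  elim: n => [|n IH] k k0 kn.
    by move: kn; rewrite leqn0 subn_eq0 leqNgt ltn_ord.
  apply: (@linear_ode_eq0 R (fun s => - G s k k) _ 0) => [s|s|].
  - by apply: cvgN; exact: Gc.
  - apply: is_derive_eq (qd s k 0) _.
    rewrite -mulmxBl mxE (bigD1 k)//= big1 ?addr0 => [|l lk].
      by rewrite !mxE ltnn sub0r.
    have [lt_lk|] := ltnP l k; first by rewrite !mxE lt_lk subrr mul0r.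
    rewrite leq_eqVlt eq_sym (negbTE (lk : (l : nat) != k)) /= => lt_kl.
    rewrite IH ?mulr0 -?lt0n ?(leq_trans _ lt_kl)//.
    by rewrite -ltnS (leq_trans _ kn)// ltn_sub2l// ltn_ord.
  - exact: q0.
by move=> j0; apply: (qk (N - j)%N).
Qed.

Lemma toda_lop_extremal t l (Q : {poly R}) : (l < N)%N ->
  Q \is monic -> size Q = l.+1 ->
  \sum_(i < N) toda_weight i t / x i.+1 ^+ l * (P t l).[x i.+1] ^+ 2 <=
  \sum_(i < N) toda_weight i t / x i.+1 ^+ l * Q.[x i.+1] ^+ 2.
Proof.
move=> lN Qm Qs; apply: (@lop_extremal R N _ _ (b0 t) (fun i => x i.+1)
  (fun i => toda_weight i t / x i.+1 ^+ l) l Q) => //.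
  by move=> i; rewrite divr_ge0 ?exprn_ge0 ?(ltW (x_gt0 i))// ltW// toda_weight_gt0.
move=> k kl.
have at_ r : (0 < r <= N)%N -> 0 < a r t by exact: toda_a_gt0.
have bt_ r : (0 < r < N)%N -> 0 < b r t by exact: toda_b_gt0.
have wt i : toda_weights t i 0 != 0 by rewrite mxE gt_eqF// toda_weight_gt0.
have := lop_orthogonal (b0 t) (bN t) x_gt0 x_inj (root t) at_ bt_ wt
  (@toda_weights_e1 t) (k := Ordinal (ltn_trans kl lN)) (l := Ordinal lN).
rewrite -val_eqE /= (ltn_eqF kl) => /(_ isT) E; rewrite -[RHS]E.
by apply: eq_bigr => i _; rewrite mxE.
Qed.

End TodaFlow.

(** * Asymptotics *)

Section Asymptotics.
Context {R : realType} (FF : set_system R) {PFF : ProperFilter FF}.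
Implicit Types (f g : R -> R).

Lemma cvg0_mulIr f g (l : R) : l != 0 ->
  f t * g t @[t --> FF] --> (0 : R) -> g t @[t --> FF] --> l ->
  f t @[t --> FF] --> (0 : R).
Proof.
move=> l0 fg gl.
have H : f t * g t * (g t)^-1 @[t --> FF] --> 0 * l^-1.
  by apply: cvgM fg _; apply: cvgV.
rewrite mul0r in H; apply: cvg_trans H; apply: near_eq_cvg.
by near=> t; rewrite mulfK//; near: t; exact: (cvgr_neq0 _ gl).
Unshelve. all: by end_near. Qed.

Lemma cvg_sqr0 f : f t ^+ 2 @[t --> FF] --> (0 : R) -> f t @[t --> FF] --> (0 : R).
Proof.
move=> f2; apply/norm_cvg0P.
have -> : (fun t => `|f t|) = (fun t => Num.sqrt (f t ^+ 2)).
  by apply/funext => t; rewrite sqrtr_sqr.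
by rewrite -(@sqrtr0 R); apply: continuous_cvg f2; exact: sqrt_continuous.
Qed.

Lemma lop_cvg (a b : nat -> R -> R) (al : nat -> R) y k :
  (forall j, (0 < j <= k)%N -> a j t @[t --> FF] --> al j) ->
  (forall j, (j < k)%N -> b j t @[t --> FF] --> (0 : R)) ->
  (lop (a ^~ t) (b ^~ t) k).[y] @[t --> FF] -->
    \prod_(1 <= j < k.+1) (y - al j).
Proof.
suff H n : (n <= k)%N ->
  (forall j, (0 < j <= k)%N -> a j t @[t --> FF] --> al j) ->
  (forall j, (j < k)%N -> b j t @[t --> FF] --> (0 : R)) ->
  ((lop (a ^~ t) (b ^~ t) n).[y] @[t --> FF] --> \prod_(1 <= j < n.+1) (y - al j)) /\
  ((lop (a ^~ t) (b ^~ t) n.-1).[y] @[t --> FF] --> \prod_(1 <= j < n.-1.+1) (y - al j)).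
  by move=> ha hb; case: (H k (leqnn k) ha hb).
move=> + ha hb; elim: n => [_|n IH nk].
  have P0 : (lop (a ^~ t) (b ^~ t) 0).[y] @[t --> FF] --> \prod_(1 <= j < 1) (y - al j).
    rewrite big_geq//; have -> : (fun t => (lop (a ^~ t) (b ^~ t) 0).[y]) = cst 1.
      by apply/funext => t; rewrite lop0_horner.
    exact: cvg_cst.
  by split; exact: P0.
have [Pn Pn1] := IH (ltnW nk); split; last exact: Pn.
have -> : (fun t => (lop (a ^~ t) (b ^~ t) n.+1).[y]) =
  (fun t => (y - a n.+1 t) * (lop (a ^~ t) (b ^~ t) n).[y]
            - y * b n t * (lop (a ^~ t) (b ^~ t) n.-1).[y]).
  by apply/funext => t; rewrite lopS_horner.
rewrite big_nat_recr//=.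
rewrite [X in _ --> X](_ : _ = (y - al n.+1) * \prod_(1 <= j < n.+1) (y - al j)
  - y * 0 * \prod_(1 <= j < n.-1.+1) (y - al j)); last ring.
apply: cvgB; apply: cvgM => //.
  by apply: cvgB; [exact: cvg_cst|exact: ha].
by apply: cvgM; [exact: cvg_cst|exact: hb].
Qed.

Lemma prod_sub_neq0 (al : nat -> R) y k :
  (forall j, (0 < j <= k)%N -> y != al j) ->
  \prod_(1 <= j < k.+1) (y - al j) != 0.
Proof.
move=> yal; rewrite prodf_seq_neq0; apply/allP => j.
by rewrite mem_index_iota ltnS subr_eq0 => /yal.
Qed.

(** In the limit consecutive polynomials differ by one linear factor. Quotients of this kind carry
    the [1 + o(1)] factors of the expansion. *)
Lemma lop_ratio_cvg (a b : nat -> R -> R) (al : nat -> R) y k :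
  (forall j, (0 < j <= k.+1)%N -> a j t @[t --> FF] --> al j) ->
  (forall j, (j < k.+1)%N -> b j t @[t --> FF] --> (0 : R)) ->
  (forall j, (0 < j <= k.+1)%N -> y != al j) ->
  (y - al k.+1) * ((lop (a ^~ t) (b ^~ t) k).[y] /
     (lop (a ^~ t) (b ^~ t) k.+1).[y]) - 1 @[t --> FF] --> (0 : R).
Proof.
move=> ha hb yal.
have Pk1 := lop_cvg (y := y) ha hb.
have Pk : (lop (a ^~ t) (b ^~ t) k).[y] @[t --> FF] --> \prod_(1 <= j < k.+1) (y - al j).
  apply: lop_cvg => j; last by move=> jk; apply: hb; rewrite ltnW.
  by move=> /andP[j0 jk]; apply: ha; rewrite j0 ltnW.
have n1 := prod_sub_neq0 yal.
have nk : \prod_(1 <= j < k.+1) (y - al j) != 0.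
  by apply: prod_sub_neq0 => j /andP[j0 jk]; apply: yal; rewrite j0 ltnW.
have yk : y - al k.+1 != 0 by rewrite subr_eq0 yal//= leqnn.
rewrite [X in _ --> X](_ : _ = (y - al k.+1) * (\prod_(1 <= j < k.+1) (y - al j) /
   \prod_(1 <= j < k.+2) (y - al j)) - 1); last first.
  by rewrite [X in _ / X]big_nat_recr//=; field; rewrite nk yk.
apply: cvgB; last exact: cvg_cst.
by apply: cvgM; [exact: cvg_cst|apply: cvgM => //; exact: cvgV].
Qed.

(* Once the parameters below [n] converge, [P_(n+1)] at [x_n] and [x_(n+1)]
   gives two linear equations for [x_(n+1) - a_(n+1)] and [b_n] with vanishing
   right-hand sides, whose determinant has a nonzero limit. *)
Lemma lop_params_cvg N (a b : nat -> R -> R) (x : nat -> R) :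
  (forall t, b 0%N t = 0) ->
  (forall k, (0 < k <= N)%N -> 0 < x k) ->
  {in [pred k | (0 < k <= N)%N] &, injective x} ->
  (forall i k, (0 < i <= k)%N -> (k <= N)%N ->
    (lop (a ^~ t) (b ^~ t) k).[x i] @[t --> FF] --> (0 : R)) ->
  (forall k, (0 < k <= N)%N -> a k t @[t --> FF] --> x k) /\
  (forall k, (k < N)%N -> b k t @[t --> FF] --> (0 : R)).
Proof.
move=> b0 x_pos x_inj P0.
pose p k y t := (lop (a ^~ t) (b ^~ t) k).[y].
have bc0 : b 0%N t @[t --> FF] --> (0 : R).
  by have -> : b 0%N = cst 0; [exact/funext|exact: cvg_cst].
suff H n : (n <= N)%N ->
    (forall k, (0 < k <= n)%N -> a k t @[t --> FF] --> x k) /\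
    (forall k, (k < n)%N -> b k t @[t --> FF] --> (0 : R)) by exact: (H N).
elim: n => [_|n IH nN]; first by split=> k; case: k.
have [ha hb] := IH (ltnW nN).
suff [an bn] : (a n.+1 t @[t --> FF] --> x n.+1) /\ (b n t @[t --> FF] --> (0 : R)).
  split=> k; first rewrite (leq_eqVlt k).
    by move=> /andP[k0 /predU1P[->//|kn]]; apply: ha; rewrite k0.
  by rewrite ltnS leq_eqVlt => /predU1P[->|kn]//; exact: hb.
pose q := x n.+1; pose al t := q - a n.+1 t.
suff [aln bn] : (al t @[t --> FF] --> (0 : R)) /\ (b n t @[t --> FF] --> (0 : R)).
  split=> //; have -> : a n.+1 = (fun t => q - al t).
    by apply/funext => t; rewrite /al subKr.
  by rewrite -[x n.+1]subr0; apply: cvgB => //; exact: cvg_cst.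
have Pn1 i : (0 < i <= n.+1)%N -> p n.+1 (x i) t @[t --> FF] --> (0 : R).
  by move=> i1; exact: P0.
case: n IH nN ha hb @q @al Pn1 => [|n] _ nN ha hb q al Pn1.
  split=> //; have -> : al = p 1%N q.
    by apply/funext => t; rewrite /p lopS_horner b0 lop0_horner /al; ring.
  exact: Pn1.
pose r := x n.+1.
have ne j : (0 < j <= n.+1)%N -> q != x j.
  move=> /andP[j0 jn]; apply/eqP => /x_inj; rewrite !inE j0 nN.
  rewrite (leq_trans jn (ltnW nN)) => /(_ isT isT) jE.
  by move: jn; rewrite -jE ltnn.
have ner j : (0 < j <= n)%N -> r != x j.
  move=> /andP[j0 jn]; apply/eqP => /x_inj; rewrite !inE j0 (ltnW nN).
  rewrite (leq_trans jn (ltnW (ltnW nN))) => /(_ isT isT) jE.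
  by move: jn; rewrite -jE ltnn.
have ha' j : (0 < j <= n)%N -> a j t @[t --> FF] --> x j.
  by move=> /andP[j0 jn]; apply: ha; rewrite j0 ltnW.
have hb' j : (j < n)%N -> b j t @[t --> FF] --> (0 : R).
  by move=> jn; apply: hb; rewrite ltnW.
have pr : p n.+1 r t @[t --> FF] --> (0 : R) by apply: P0 (ltnW nN); rewrite /= leqnn.
have pq : p n.+1 q t @[t --> FF] --> _ := lop_cvg (y := q) ha hb.
have pr1 : p n r t @[t --> FF] --> _ := lop_cvg (y := r) ha' hb'.
have pq1 : p n q t @[t --> FF] --> _ := lop_cvg (y := q) ha' hb'.
have e2 : p n.+2 q t @[t --> FF] --> (0 : R) by apply: Pn1; rewrite /= leqnn.
(* The correction replaces [r - a n.+2] by [al = q - a n.+2] in the recurrence at [r], so that both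
   equations share the unknown [al]. *)
have e1 : p n.+2 r t + (q - r) * p n.+1 r t @[t --> FF] --> (0 : R).
  rewrite [X in _ --> X](_ : _ = 0 + (q - r) * 0); last ring.
  apply: cvgD; first by apply: Pn1; rewrite /= ltnW.
  by apply: cvgM => //; exact: cvg_cst.
pose E1 t := p n.+2 r t + (q - r) * p n.+1 r t.
(* The Cramer determinant of the system in [al t] and [b n.+1 t]. Its first product tends to 0 with
   [p n.+1 r]; the second has a nonzero limit because the nodes are distinct and [r] is positive. *)
pose De t := p n.+1 r t * - (q * p n q t) + p n.+1 q t * (r * p n r t).
have qr0 : r * (\prod_(1 <= j < n.+2) (q - x j) * \prod_(1 <= j < n.+1) (r - x j)) != 0.
  rewrite !mulf_neq0 ?prod_sub_neq0//.
  by rewrite gt_eqF// /r x_pos//= ltnW.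
have Dec : De t @[t --> FF] -->
    r * (\prod_(1 <= j < n.+2) (q - x j) * \prod_(1 <= j < n.+1) (r - x j)).
  rewrite [X in _ --> X](_ : _ = 0 * - (q * \prod_(1 <= j < n.+1) (q - x j)) +
     \prod_(1 <= j < n.+2) (q - x j) * (r * \prod_(1 <= j < n.+1) (r - x j))); last ring.
  apply: cvgD; apply: cvgM => //.
    by apply: cvgN; apply: cvgM => //; exact: cvg_cst.
  by apply: cvgM => //; exact: cvg_cst.
split; apply: (cvg0_mulIr qr0 _ Dec).
  have -> : (fun t => al t * De t) =
      (fun t => E1 t * - (q * p n q t) + p n.+2 q t * (r * p n r t)).
    by apply/funext => t; rewrite /E1 /De /p !(lopS_horner _ _ n.+1) /al /=; ring.
  rewrite [X in _ --> X](_ : _ = 0 * - (q * \prod_(1 <= j < n.+1) (q - x j)) +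
     0 * (r * \prod_(1 <= j < n.+1) (r - x j))); last ring.
  apply: cvgD; apply: cvgM => //.
    by apply: cvgN; apply: cvgM => //; exact: cvg_cst.
  by apply: cvgM => //; exact: cvg_cst.
have -> : (fun t => b n.+1 t * De t) =
    (fun t => p n.+1 r t * p n.+2 q t - p n.+1 q t * E1 t).
  by apply/funext => t; rewrite /E1 /De /p !(lopS_horner _ _ n.+1) /=; ring.
rewrite [X in _ --> X](_ : _ = 0 * 0 - \prod_(1 <= j < n.+2) (q - x j) * 0); last ring.
by apply: cvgB; apply: cvgM.
Qed.

End Asymptotics.

(** * Limits of the data and the expansion around one row *)

Section TodaAsymptotics.
Context {R : realType} (FF : set_system R) {PFF : ProperFilter FF}.
Variables (N : nat) (a b : nat -> R -> R) (x : nat -> R).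
Hypotheses (b0 : forall t, b 0%N t = 0) (bN : forall t, b N t = 0)
  (x_pos : forall k, (1 <= k <= N)%N -> 0 < x k)
  (x_inj : {in [pred k | (0 < k <= N)%N] &, injective x}).

(** The decay hypothesis says that along [FF] a node of smaller index carries a dominating weight;
    the direction of time enters only here. *)
Lemma toda_lop_cvg0 (F : R -> R) : (0 < N)%N ->
  toda_solution F (fun t => Lmx N (a ^~ t)) (fun t => Mmx N (b ^~ t)) ->
  (forall k, (1 <= k <= N)%N -> 0 < a k 0) ->
  (forall k, (1 <= k < N)%N -> 0 < b k 0) ->
  (forall k, (1 <= k <= N)%N ->
     gen_eigenvalue (Lmx N (a ^~ 0)) (Mmx N (b ^~ 0)) (x k)) ->
  (forall i j, (0 < i < j)%N -> (j <= N)%N ->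
     expR ((F (x i) - F (x j)) * t) @[t --> FF] --> (0 : R)) ->
  forall i k, (0 < i <= k)%N -> (k <= N)%N ->
    (lop (a ^~ t) (b ^~ t) k).[x i] @[t --> FF] --> (0 : R).
Proof.
move=> N0 sol a_pos b_pos x_eig decay i k /andP[i0 ik].
rewrite leq_eqVlt => /predU1P[kN|kN].
  rewrite {}kN in ik *; have -> : (fun t => (lop (a ^~ t) (b ^~ t) N).[x i]) = cst 0.
    apply/funext => t; apply: (toda_root N0 sol b0 bN x_eig).
    by rewrite i0 ik.
  exact: cvg_cst.
pose Q : {poly R} := \prod_(1 <= j < k.+1) ('X - (x j)%:P).
have Qm : Q \is monic by apply: monic_prod_XsubC.
have Qs : size Q = k.+1 by rewrite size_prod_XsubC size_iota subn1.
have Q0 j : (0 < j <= k)%N -> Q.[x j] = 0.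
  move=> jk; rewrite horner_prod; apply/eqP; rewrite prodf_seq_eq0.
  apply/hasP; exists j; first by rewrite mem_index_iota.
  by rewrite hornerXsubC subrr eqxx.
pose w (j : 'I_N) := toda_weight F a b x j.
have [i1 iN] : i = i.-1.+1 /\ (i.-1 < N)%N.
  by rewrite prednK//; split=> //; rewrite (leq_trans ik)// ltnW.
pose i' := Ordinal iN.
have w_gt0 j t : 0 < w j t by exact: toda_weight_gt0.
(* The terms of the extremal bound divided by the mass at [x i]. Those with [j < k] vanish since [Q]
   does; the others have [i <= k < j.+1], so their weight ratio decays. *)
pose g (j : 'I_N) t := w j t / w i' t * (x i ^+ k / x j.+1 ^+ k * Q.[x j.+1] ^+ 2).
have xk j : (0 < j <= N)%N -> 0 < x j ^+ k by move=> jN; rewrite exprn_gt0// x_pos.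
have iN' : (0 < i <= N)%N by rewrite i0 (leq_trans ik)// ltnW.
have Pg t : (lop (a ^~ t) (b ^~ t) k).[x i] ^+ 2 <= \sum_j g j t.
  have wi : 0 < w i' t / x i ^+ k by rewrite divr_gt0// xk.
  rewrite -(ler_pM2l wi) mulr_sumr.
  apply: (@le_trans _ _ (\sum_(j < N) w j t / x j.+1 ^+ k * Q.[x j.+1] ^+ 2)).
    apply: le_trans (toda_lop_extremal N0 sol a_pos b_pos b0 bN x_pos x_inj
      x_eig t kN Qm Qs).
    rewrite (bigD1 i')//= -i1 lerDl; apply: sumr_ge0 => j _.
    by rewrite mulr_ge0 ?sqr_ge0// ltW// divr_gt0 ?w_gt0 ?xk//= ltn_ord.
  apply: ler_sum => j _; rewrite le_eqVlt /g; apply/orP; left; apply/eqP.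
  have := xk j.+1 (ltn_ord j); have := xk i iN'; have := w_gt0 i' t.
  move: (w i' t) (w j t) (x i ^+ k) (x j.+1 ^+ k) => wi' wj xi xj wi0 xi0 xj0.
  by field; rewrite !gt_eqF.
have g0 j : g j t @[t --> FF] --> (0 : R).
  have [jk|kj] := leqP j.+1 k.
    have -> : g j = cst 0; last exact: cvg_cst.
    by apply/funext => t; rewrite /g Q0 ?expr0n/= ?mulr0.
  have jN := ltn_ord j.
  pose C := lop_norm N (a ^~ 0) (b ^~ 0) (x i) / lop_norm N (a ^~ 0) (b ^~ 0) (x j.+1).
  have -> : g j = (fun t => C * expR ((F (x i) - F (x j.+1)) * t) *
      (x i ^+ k / x j.+1 ^+ k * Q.[x j.+1] ^+ 2)).
    apply/funext => t; rewrite /g; congr (_ * _).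
    have -> : expR ((F (x i) - F (x j.+1)) * t) =
        expR (- F (x j.+1) * t) / expR (- F (x i) * t).
      by rewrite -expRN -expRD; congr expR; ring.
    by rewrite /w /toda_weight /C -i1 invfM invrK; ring.
  rewrite [X in _ --> X](_ : _ = C * 0 * (x i ^+ k / x j.+1 ^+ k * Q.[x j.+1] ^+ 2));
    last by rewrite mulr0 mul0r.
  apply: cvgM; last exact: cvg_cst.
  apply: cvgM; first exact: cvg_cst.
  by apply: decay => //; rewrite i0 (leq_ltn_trans ik).
apply: cvg_sqr0.
apply: (@squeeze_cvgr _ _ _ _ (fun=> 0) (fun t => \sum_j g j t)).
- by near=> t; rewrite sqr_ge0 Pg.
- exact: cvg_cst.
- rewrite [X in _ --> X](_ : _ = \sum_(j < N) 0); last by rewrite big1.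
  exact: (@cvg_big _ _ +%R 0 xpredT add_continuous _ _ _ g (fun=> 0) _
    (fun j _ => g0 j)).
Unshelve. all: by end_near. Qed.

(** The tridiagonal determinant is cut between leading and trailing blocks; reversed parameters
    generate the trailing ones. The induction starts at [m = N], where [b1 N = 0] removes the
    coupling, and moves one row at a time to the trailing block. *)
Lemma lop_split (a1 b1 : nat -> R) y m : b1 N = 0 -> (m <= N)%N ->
  (lop a1 b1 N).[y] =
  (lop a1 b1 m).[y] *
    (lop (fun j => a1 (N.+1 - j)%N) (fun j => b1 (N - j)%N) (N - m)).[y]
  - y * b1 m * (lop a1 b1 m.-1).[y] *
    (lop (fun j => a1 (N.+1 - j)%N) (fun j => b1 (N - j)%N) (N - m).-1).[y].
Proof.
move=> b1N mN; rewrite -(subKn mN); move: (leq_subr m N).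
move: (N - m)%N => d; elim: d => [_|d IH dN].
  by rewrite subn0 subnn b1N lop0_horner; ring.
rewrite IH; last exact: ltnW.
rewrite subKn 1?ltnW// subKn//.
have [r rE] : exists r, (N - d)%N = r.+1 by exists (N - d.+1)%N; rewrite -subSn.
have rE' : (N - d.+1)%N = r by rewrite subnS rE.
rewrite rE rE' !lopS_horner rE [d.+1.-1]/= [r.+1.-1]/=.
by rewrite subSS rE; ring.
Qed.

Lemma toda_expansion n : (1 <= n <= N)%N ->
  (forall t, (lop (a ^~ t) (b ^~ t) N).[x n] = 0) ->
  (forall k, (0 < k <= N)%N -> a k t @[t --> FF] --> x k) ->
  (forall k, (k < N)%N -> b k t @[t --> FF] --> (0 : R)) ->
  exists e1 e2 : R -> R,
   [/\ e1 t @[t --> FF] --> (0 : R), e2 t @[t --> FF] --> (0 : R) &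
    \forall t \near FF, x n - a n t =
      x n / (x n - x n.+1) * b n t * (1 + e1 t)
      - x n / (x n.-1 - x n) * b n.-1 t * (1 + e2 t)].
Proof.
move=> /andP[n0 nN] root ha hb.
have ne j : (0 < j <= N)%N -> j != n -> x n != x j.
  move=> jN jn; apply/eqP => /x_inj; rewrite !inE n0 nN jN => /(_ isT isT) nj.
  by rewrite nj eqxx in jn.
pose a' j := a (N.+1 - j)%N; pose b' j := b (N - j)%N.
pose x' j := x (N.+1 - j)%N.
pose p k t := (lop (a ^~ t) (b ^~ t) k).[x n].
pose p' k t := (lop (a' ^~ t) (b' ^~ t) k).[x n].
have ha' j : (0 < j <= N)%N -> a' j t @[t --> FF] --> x' j.
  by move=> /andP[j0 jN]; apply: ha; lia.
have hb' j : (j < N)%N -> b' j t @[t --> FF] --> (0 : R).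
  case: j => [_|j jN]; last by apply: hb; lia.
  by rewrite /b' subn0; have -> : b N = cst 0; [exact/funext|exact: cvg_cst].
(* Dividing the split equation by [p n.-1 * p' (N - n)] expresses [x n - a n] exactly through two
   quotients, and the errors are their relative deviations from the limits. At [n = N] and [n = 1]
   the coefficient [b N] or [b 0] is zero, so the value 0 is a mere default. *)
exists (fun t => if n == N then 0
   else (x n - x n.+1) * (p' (N - n).-1 t / p' (N - n)%N t) - 1).
exists (fun t => if n == 1%N then 0
   else (x n - x n.-1) * (p n.-2 t / p n.-1 t) - 1).
split.
- have [_|nN'] := eqVneq n N; first exact: cvg_cst.
  have [r rE] : exists r, (N - n)%N = r.+1 by exists (N - n.+1)%N; lia.
  rewrite rE; have -> : x n.+1 = x' r.+1 by rewrite /x'; congr (x _); lia.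
  apply: lop_ratio_cvg => j jr; [apply: ha'; lia|apply: hb'; lia|].
  by apply: ne; lia.
- have [_|n1] := eqVneq n 1%N; first exact: cvg_cst.
  have [r rE] : exists r, n.-1 = r.+1 by exists n.-2; lia.
  rewrite rE.
  apply: lop_ratio_cvg => j jr; [apply: ha; lia|apply: hb; lia|].
  by apply: ne; lia.
have pu : p n.-1 t @[t --> FF] --> \prod_(1 <= j < n.-1.+1) (x n - x j).
  by apply: lop_cvg => j jn; [apply: ha; lia|apply: hb; lia].
have pv : p' (N - n)%N t @[t --> FF] --> \prod_(1 <= j < (N - n).+1) (x n - x' j).
  by apply: lop_cvg => j jn; [apply: ha'; lia|apply: hb'; lia].
near=> t.
have u0 : p n.-1 t != 0.
  near: t; apply: cvgr_neq0 pu _; apply: prod_sub_neq0 => j jn; apply: ne; lia.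
have v0 : p' (N - n)%N t != 0.
  near: t; apply: cvgr_neq0 pv _; apply: prod_sub_neq0 => j jn; apply: ne; lia.
have := root t; rewrite (lop_split _ _ (bN t) nN).
rewrite -/(p' (N - n)%N t) -/(p' (N - n).-1 t) -/(p n.-1 t).
rewrite -[in lop _ _ n](prednK n0) lopS_horner prednK// -/(p n.-1 t) -/(p n.-2 t) => E.
have -> : x n - a n t = x n * b n t * (p' (N - n).-1 t / p' (N - n)%N t)
    + x n * b n.-1 t * (p n.-2 t / p n.-1 t).
  apply: (mulIf (mulf_neq0 u0 v0)); apply: subr0_eq; rewrite -[RHS]E.
  move: (p _ t) (p' (N - n)%N t) u0 v0 => u v u0 v0.
  by field; rewrite u0 v0.
congr (_ + _).
  have [nN'|nN'] := eqVneq n N; first by rewrite nN' bN; ring.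
  have d0 : x n - x n.+1 != 0 by rewrite subr_eq0 ne//; lia.
  by move: (_ / _ : R) => e; field.
have [n1|n1] := eqVneq n 1%N; first by rewrite n1 b0; ring.
have d0 : x n - x n.-1 != 0 by rewrite subr_eq0 ne//; lia.
have d1 : x n.-1 - x n != 0 by rewrite -opprB oppr_eq0.
by move: (_ / _ : R) => e; field.
Unshelve. all: by end_near. Qed.

End TodaAsymptotics.

Lemma cvg_expR_pinfty (R : realType) (c : R) : c < 0 ->
  expR (c * t) @[t --> +oo] --> (0 : R).
Proof.
move=> c0; apply/cvgr0Pnorm_lt => e e0; near=> t.
rewrite ger0_norm ?expR_ge0// -[ltRHS]lnK// ltr_expR mulrC -ltr_ndivrMr//.
by near: t; apply: nbhs_pinfty_gt; rewrite num_real.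
Unshelve. all: by end_near. Qed.

Lemma cvg_expR_ninfty (R : realType) (c : R) : 0 < c ->
  expR (c * t) @[t --> -oo] --> (0 : R).
Proof.
move=> c0; apply/cvgr0Pnorm_lt => e e0; near=> t.
rewrite ger0_norm ?expR_ge0// -[ltRHS]lnK// ltr_expR mulrC -ltr_pdivlMr//.
by near: t; apply: nbhs_ninfty_lt; rewrite num_real.
Unshelve. all: by end_near. Qed.

(** Stated for any enumeration [x] of the eigenvalues and any proper filter compatible with it, so
    that both ends of time are instances. *)
Lemma toda_asymptotics (R : realType) (FF : set_system R) (PFF : ProperFilter FF)
    (N : nat) (F : R -> R) (a b : nat -> R -> R) (x : nat -> R) (n : nat) :
  toda_solution F (fun t => Lmx N (a ^~ t)) (fun t => Mmx N (b ^~ t)) ->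
  (forall k, (1 <= k <= N)%N -> 0 < a k 0) ->
  (forall k, (1 <= k < N)%N -> 0 < b k 0) ->
  (forall t, b 0%N t = 0) -> (forall t, b N t = 0) ->
  (forall k, (1 <= k <= N)%N -> 0 < x k) ->
  {in [pred k | (0 < k <= N)%N] &, injective x} ->
  (forall k, (1 <= k <= N)%N ->
     gen_eigenvalue (Lmx N (a ^~ 0)) (Mmx N (b ^~ 0)) (x k)) ->
  (forall i j, (0 < i < j)%N -> (j <= N)%N ->
     expR ((F (x i) - F (x j)) * t) @[t --> FF] --> (0 : R)) ->
  (1 <= n <= N)%N ->
  exists e1 e2 : R -> R,
   [/\ e1 t @[t --> FF] --> (0 : R), e2 t @[t --> FF] --> (0 : R) &
    \forall t \near FF, x n - a n t =
      x n / (x n - x n.+1) * b n t * (1 + e1 t)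
      - x n / (x n.-1 - x n) * b n.-1 t * (1 + e2 t)].
Proof.
move=> sol a_pos b_pos b0 bN x_pos x_inj x_eig decay nN.
have N0 : (0 < N)%N by lia.
have P0 := toda_lop_cvg0 b0 bN x_pos x_inj N0 sol a_pos b_pos x_eig decay.
have [ha hb] := lop_params_cvg b0 x_pos x_inj (P0 _).
apply: (toda_expansion (N := N)) => // t.
exact: (toda_root N0 sol b0 bN x_eig).
Qed.

Theorem theorem4p4 (R : realType) (N : nat) (F : R -> R)
    (a b : nat -> R -> R) (lam : nat -> R) (n : nat)
    (F_incr : {in Num.pos &, {homo F : x y / x < y}})
    (sol : toda_solution F (fun t => Lmx N (a ^~ t)) (fun t => Mmx N (b ^~ t)))
    (a_pos : forall k, (1 <= k <= N)%N -> 0 < a k 0)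
    (b_pos : forall k, (1 <= k < N)%N -> 0 < b k 0)
    (b0 : forall t, b 0%N t = 0)
    (bN : forall t, b N t = 0)
    (lam_pos : forall k, (1 <= k <= N)%N -> 0 < lam k)
    (lam_incr : forall k, (1 <= k < N)%N -> lam k < lam k.+1)
    (lam_eig : forall k, (1 <= k <= N)%N ->
       gen_eigenvalue (Lmx N (a ^~ 0)) (Mmx N (b ^~ 0)) (lam k))
    (n_range : (1 <= n <= N)%N) :
  (exists e1 e2 : R -> R,
     [/\ e1 t @[t --> +oo] --> (0 : R),
         e2 t @[t --> +oo] --> (0 : R)
       & \forall t \near +oo,
           lam n - a n t =
             lam n / (lam n - lam n.+1) * b n t * (1 + e1 t)
           - lam n / (lam n.-1 - lam n) * b n.-1 t * (1 + e2 t)]) /\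
  (exists e1 e2 : R -> R,
     let m := (N - n).+1 in
     [/\ e1 t @[t --> -oo] --> (0 : R),
         e2 t @[t --> -oo] --> (0 : R)
       & \forall t \near -oo,
           lam m - a n t =
             lam m / (lam m - lam m.-1) * b n t * (1 + e1 t)
           - lam m / (lam m.+1 - lam m) * b n.-1 t * (1 + e2 t)]).
Proof.
have lam_lt j i : (1 <= i < j)%N -> (j <= N)%N -> lam i < lam j.
  move=> /andP[i1]; elim: j => // j IH; rewrite ltnS leq_eqVlt => /predU1P[<-|ij] jN.
    by apply: lam_incr; rewrite i1.
  by apply: lt_trans (IH ij (ltnW jN)) _; apply: lam_incr; lia.
have lam_inj : {in [pred k | (0 < k <= N)%N] &, injective lam}.
  move=> i j; rewrite !inE => iN jN eij.
  have [ij|ji|//] := ltngtP i j.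
    by have := lam_lt j i; rewrite eij ltxx; lia.
  by have := lam_lt i j; rewrite eij ltxx; lia.
have F_lt i j : (1 <= i < j)%N -> (j <= N)%N -> F (lam i) < F (lam j).
  by move=> ij jN; apply: F_incr; rewrite ?posrE ?lam_lt// lam_pos//; lia.
split.
  apply: toda_asymptotics sol a_pos b_pos b0 bN lam_pos lam_inj lam_eig _ n_range.
  by move=> i j ij jN; apply: cvg_expR_pinfty; rewrite subr_lt0 F_lt.
pose mu k := lam (N.+1 - k)%N.
have mu_pos k : (1 <= k <= N)%N -> 0 < mu k by move=> kN; apply: lam_pos; lia.
have mu_inj : {in [pred k | (0 < k <= N)%N] &, injective mu}.
  move=> i j; rewrite !inE => iN jN.
  have iN' : (0 < N.+1 - i <= N)%N by lia.
  have jN' : (0 < N.+1 - j <= N)%N by lia.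
  by move=> /(lam_inj _ _ iN' jN'); lia.
have mu_eig k : (1 <= k <= N)%N ->
    gen_eigenvalue (Lmx N (a ^~ 0)) (Mmx N (b ^~ 0)) (mu k).
  by move=> kN; apply: lam_eig; lia.
have := @toda_asymptotics R (-oo) _ N F a b mu n sol a_pos b_pos b0 bN mu_pos
  mu_inj mu_eig _ n_range.
(* The neighbours of [mu n] become those of [lam (N - n).+1] in swapped order. At [n = N] and
   [n = 1] they are [lam 0] and [lam N.+1], multiplied by [b N] and [b 0]. *)
have -> : mu n = lam (N - n).+1 by rewrite /mu; congr lam; lia.
have -> : mu n.+1 = lam (N - n).+1.-1 by rewrite /mu; congr lam; lia.
have -> : mu n.-1 = lam (N - n).+2 by rewrite /mu; congr lam; lia.
apply=> i j ij jN; apply: cvg_expR_ninfty; rewrite subr_gt0 F_lt//; lia.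
Qed.
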